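(* Let $\alpha,\beta$ be nonzero distinct real numbers, and consider the four points $(t_1,\xi_1)=(0,0)$, $(t_2,\xi_2)=(1,0)$, $(t_3,\xi_3)=(1,\alpha)$, $(t_4,\xi_4)=(1,\beta)$. Assume that at least one of the following holds: (a) there exists $\gamma>1$ such that $$\liminf_{n\to\infty}\, n^{\gamma}\min\Big\{\Big\|n\frac{\beta}{\alpha}\Big\|,\Big\|n\frac{\alpha}{\beta}\Big\|\Big\}<\infty;$$ (b) at least one of $\alpha,\beta$ is rational. Then there is no $f\in L^2(\mathbb{R})$, $f:\mathbb{R}\to\mathbb{C}$, not a.e. equal to zero, for which there exist complex numbers $d_1,\dots,d_4$, not all zero, with $$\sum_{j=1}^4 d_j f(x+t_j)e^{2\pi i \xi_j x}=0\quad\text{for a.e. }x\in\mathbb{R}.$$ Moreover, in either case, there is no measurable function $f:\mathbb{R}\to\mathbb{C}$, not a.e. equal to zero, which satisfies such a relation with coefficients $d_1,\dots,d_4$ not all zero and which has the minimal decay $$\lim_{|n|\to\infty,\ n\in\mathbb{Z}}|f(x+n)|=0\quad\text{for a.e. }x.$$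
   Context: $\|x\|$ denotes the distance from the real number $x$ to the nearest integer. *)

(* Defs.v *)
From HB Require Import structures.
From mathcomp Require Import all_boot all_order all_algebra.
From mathcomp Require Import all_classical all_reals all_analysis.
From mathcomp Require Import complex.

Set Implicit Arguments.
Unset Strict Implicit.
Unset Printing Implicit Defensive.

Import Order.TTheory GRing.Theory Num.Theory numFieldNormedType.Exports.

Local Open Scope classical_set_scope.
Local Open Scope ring_scope.

Definition dist_int (R : realType) (x : R) : R :=
  inf [set `|x - k%:~R| | k in [set: int]].

(* [measurableTypeR R] carries only the Borel sets.  The Lebesgue measurable
   sets are the Caratheodory measurable sets of the outer measure underlying
   [completed_lebesgue_measure]; the carrier of this type is [R]. *)
Definition lebesgue_space (R : realType) :=
  caratheodory_type ((@wlength R idfun)^*)%mu.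

Definition lebesgue_measurable_fun (R : realType) (f : R -> R[i]) : Prop :=
  forall U : set R[i]^o, open U ->
    measurable (f @^-1` U : set (lebesgue_space R)).

Definition lebesgue_ae (R : realType) (P : R -> Prop) : Prop :=
  {ae @completed_lebesgue_measure R, forall x, P x}.

(* The library's norm on [R[i]] takes values in [R[i]]; [Normc.normc] is the
   real-valued modulus. *)
Definition in_L2 (R : realType) (f : R -> R[i]) : Prop :=
  lebesgue_measurable_fun f /\
  (\int[@completed_lebesgue_measure R]_x ((Normc.normc (f x)) ^+ 2)%:E
     < +oo)%E.

Definition cexpi (R : realType) (t : R) : R[i] := Complex (cos t) (sin t).

(* [p j] is the time-frequency point (t_j, xi_j). *)
Definition tf_relation (R : realType) (N : nat) (p : 'I_N -> R * R)
    (d : 'I_N -> R[i]) (f : R -> R[i]) : Prop :=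
  lebesgue_ae (fun x =>
    \sum_(j < N) d j * f (x + (p j).1) * cexpi (2 * pi * (p j).2 * x) = 0).

Definition tf_dependent (R : realType) (N : nat) (p : 'I_N -> R * R)
    (f : R -> R[i]) : Prop :=
  exists d : 'I_N -> R[i], (exists j, d j != 0) /\ tf_relation p d f.

Definition four_points (R : realType) (alpha beta : R) (j : 'I_4) : R * R :=
  nth (0, 0) [:: (0, 0); (1, 0); (1, alpha); (1, beta)] j.

(* The filter of |n| -> +oo on the integers. *)
Definition int_infty : set_system int :=
  filter_from [set: nat] (fun N => [set n : int | (N <= `|n|)%N]).

Definition minimal_decay (R : realType) (f : R -> R[i]) : Prop :=
  lebesgue_ae (fun x =>
    (fun n : int => Normc.normc (f (x + n%:~R))) @ int_infty --> (0 : R)).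

(* Main.v *)
Require Import Defs.
From mathcomp Require Import all_boot all_order all_algebra.
From mathcomp Require Import all_classical all_reals all_analysis.
From mathcomp Require Import measurable_realfun complex.
From mathcomp Require Import ring lra zify.
Import Order.TTheory GRing.Theory Num.Theory numFieldNormedType.Exports.
Local Open Scope classical_set_scope.
Local Open Scope ring_scope.

(** Write e(t) for exp(2 pi i t).  A dependence between the four translates reads
d0 f(x) + f(x+1) T(x) = 0, where T is a trigonometric polynomial with
frequencies 0, alpha, beta.  If d0 = 0 then f vanishes off the zeros of T,
which form a null set.  Otherwise f(x) = f(x+1) P(x) with
P(x) = A + B e(alpha x) + C e(beta x), and iterating in both directions gives
  |f(x)| = |f(x+M)| |P(x) P(x+1) ... P(x+M-1)|,
  |f(x-M)| = |f(x)| |P(x-1) P(x-2) ... P(x-M)|.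
If f(x) <> 0 and f decays along x + Z, then the forward products of |P| at x
tend to infinity while the backward products tend to 0: the point x escapes
([decaying_solution_escapes]).  So it suffices to prove that for every A, B, C
almost no point escapes ([trinom_not_escape]), a statement in which f no
longer occurs.  A square integrable f decays along almost every coset of Z by
Chebyshev's inequality and the Borel-Cantelli lemma ([minimal_decay_in_L2]),
so both halves of the theorem follow.

The contradiction comes from comparing the two products.  If y is nearly a
period of |P| and y = M + theta with M an integer, then the forward product
of length M at w + theta is, factor by factor, close to the backward product
of length M at w.  The first one is at least expR 1 and the second one at
most 1/2 when both w and w + theta lie in the set S of points of [0,1) whose
products are that large and that small from some fixed length on.  If the
escaping points do not form a null set, some such S has positive measure and
meets its translates by small theta in a set whose measure is bounded below
([escape_level_recurrence]); Dirichlet's theorem makes theta small after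
replacing y by a bounded multiple.  Three cases remain.

If |P| has an exact period the two products coincide, a contradiction
([periodic_not_escape]).  This disposes of the case where one of A, B, C
vanishes and of the case where beta / alpha is rational.

If alpha is rational and A, B are nonzero (or, symmetrically, beta is rational
and A, C are nonzero), take y an integer, so that theta = 0 and recurrence is
replaced by the orbit itself: | |A + B e(alpha (x+k))| - |C| | takes finitely
many values for integers k, and for almost every x none of them is 0.  Hence
|P| is bounded below on x + Z, the choice of y = M makes |P(u+M) - P(u)| of
order 1/M, and the ratio of the two products stays bounded
([rational_frequency_not_escape]).

If n^gamma ||n beta/alpha|| stays bounded along infinitely many n, gamma > 1,
use the almost periods y = K n / alpha with K bounded.  Here
|P(u+y) - P(u)| <= delta with delta of order n^(-gamma), and the comparison of
products forces
  sum_(k<M) delta / max(delta, |P(w-k-1)|) >= 1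
on a set of w of measure at least c.  Integrate over w in [0,1) and rescale
by s = alpha x: the integral becomes that over s in [0,1) of sums in which s
moves by integer steps.  There e(alpha x) = e(s) is fixed, while e(beta x)
runs through an orbit of the rotation by beta/alpha, whose points are as well
spaced as the n-th roots of unity, over n steps, since n beta/alpha is very
close to an integer prime to n.  Among n consecutive values of |P|, all but the
smallest contribute a multiple of delta n H_n altogether, H_n being a harmonic
sum; the smallest contributes at most delta / max(delta, d(s)) with
d(s) = | |A + B e(s)| - |C| | ([block_sum_le]).  The former tends to 0 because gamma > 1, the integral of
the latter because d has null zero set ([integral_regularized_inverse_small]).
This contradicts the lower bound c ([diophantine_not_escape]).  Isolating the
smallest value is what makes tangential zeros of P harmless. *)

Set Implicit Arguments.
Unset Strict Implicit.
Unset Printing Implicit Defensive.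
Import Normc.

(** * Affine changes of variables for Lebesgue measure *)

Section affine_change_of_variables.
Variable R : realType.
Local Notation mu := (@lebesgue_measure R).

Let affine (c t : R) : measurableTypeR R -> measurableTypeR R :=
  fun x => c * x + t.

Let measurable_affine c t : measurable_fun [set: measurableTypeR R] (affine c t).
Proof.
by apply: measurable_funD.
Qed.

Lemma measurable_preimage_affine (c t : R) (A : set R) :
  measurable A -> measurable ((fun x => c * x + t) @^-1` A : set R).
Proof.
by move=> mA; rewrite -[X in measurable X]setTI; exact: (measurable_affine c t).
Qed.

(** Both sides are measures in A, so uniqueness of Lebesgue measure reduces the
claim to half-open intervals. *)
Lemma lebesgue_measure_affine (c t : R) (A : set R) :
  0 < c -> measurable A ->
  mu A = (c%:E * mu ((fun x => (c * x + t)%R) @^-1` A))%E.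
Proof.
move=> c0 mA.
pose k := NngNum (ltW c0).
pose nu_of : {measure set measurableTypeR R -> \bar R} :=
  mscale k (pushforward mu (affine c t)).
pose nu := nu_of (measurable_affine c t).
suff /(_ A mA) : forall X, measurable X -> mu X = nu X by [].
apply: lebesgue_measure_unique => X /ocitvP [->|[[a b] /= ab ->]].
  by rewrite !measure0.
rewrite /nu /nu_of /mscale /= /pushforward.
have -> : affine c t @^-1` `]a, b] = `](a - t) / c, (b - t) / c]%classic.
  apply/seteqP; split => x /=; rewrite /affine !in_itv /=.
    by rewrite ltr_pdivrMr// ler_pdivlMr// ltrBlDr lerBrDr mulrC.
  by rewrite ltr_pdivrMr// ler_pdivlMr// ltrBlDr lerBrDr mulrC.
rewrite !lebesgue_measure_itv/= !lte_fin ab ltr_pM2r ?invr_gt0// ltrD2r ab.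
rewrite -!EFinD -EFinM; congr EFin; field.
by rewrite gt_eqF.
Qed.

Lemma lebesgue_measure_shift (t : R) (A : set R) :
  measurable A -> mu ((fun x => (x + t)%R) @^-1` A) = mu A.
Proof.
move=> mA; rewrite (@lebesgue_measure_affine 1 t A)// mul1e.
by congr (mu _); apply/seteqP; split => x /=; rewrite mul1r.
Qed.

Lemma ge0_integral_affine (c t : R) (D : set R)
    (f : R -> \bar R) :
  0 < c -> measurable D -> measurable_fun D f ->
  (forall x, 0 <= f x)%E ->
  (\int[mu]_(y in D) f y =
   c%:E * \int[mu]_(x in (fun x => (c * x + t)%R) @^-1` D) f (c * x + t)%R)%E.
Proof.
move=> c0 mD mf f0.
pose k := NngNum (ltW c0).
pose nu_of : {measure set measurableTypeR R -> \bar R} :=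
  mscale k (pushforward mu (affine c t)).
pose nu := nu_of (measurable_affine c t).
rewrite (@eq_measure_integral _ _ _ _ nu); last first.
  by move=> A mA _; exact: (@lebesgue_measure_affine c t A).
rewrite ge0_integral_mscale//=.
by rewrite ge0_integral_pushforward//; exact: measurable_affine.
Qed.

End affine_change_of_variables.

(** * Null sets, and decay of square integrable functions along almost every coset of Z *)

Section null_sets.
Variable R : realType.
Local Notation mu := (@lebesgue_measure R).
Implicit Types (N : set R).

(** Fixes the carrier type to R: interval sets and preimages carry other,
convertible, types that defeat unification against the generic notion. *)
Definition lebesgue_null N : Prop := mu.-negligible N.

Lemma lebesgue_null_subset N' N : N `<=` N' -> lebesgue_null N' -> lebesgue_null N.
Proof. exact: (@negligibleS _ _ _ mu). Qed.

Lemma lebesgue_nullU N N' :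
  lebesgue_null N -> lebesgue_null N' -> lebesgue_null (N `|` N').
Proof. exact: (@negligibleU _ _ _ mu). Qed.

Lemma lebesgue_null_bigcup (F : (set R)^nat) :
  (forall k, lebesgue_null (F k)) -> lebesgue_null (\bigcup_k F k).
Proof. exact: (@negligible_bigcup _ _ _ mu). Qed.

(** A set is negligible for the completed measure iff its outer measure is 0 iff
it lies in a Borel null set; only Borel null sets are handled from here on. *)
Lemma lebesgue_aeE (P : R -> Prop) :
  lebesgue_ae P <-> lebesgue_null [set x | ~ P x].
Proof.
split=> [[A [mA A0 PA]]|].
  apply/negligible_outer_measure/eqP.
  rewrite eq_le outer_measure_ge0 andbT.
  by rewrite -A0; exact: (le_outer_measure ((@wlength R idfun)^*)%mu).
case=> A [mA A0 PA]; exists A; split => //.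
exact: sub_caratheodory.
Qed.

Lemma lebesgue_null_shift (t : R) N :
  lebesgue_null N -> lebesgue_null [set x | N (x + t)].
Proof.
case=> A [mA A0 NA]; exists ((fun x => x + t) @^-1` A); split.
- have := @measurable_preimage_affine R 1 t A mA.
  by congr measurable; apply/seteqP; split => x /=; rewrite mul1r.
- by rewrite -[RHS]A0; exact: lebesgue_measure_shift.
- by move=> x /NA.
Qed.

Lemma lebesgue_null_bigcup_int (F : int -> set R) :
  (forall k, lebesgue_null (F k)) -> lebesgue_null [set x | exists k, F k x].
Proof.
move=> F0; apply: (@lebesgue_null_subset
  ((\bigcup_k F (Posz k)) `|` (\bigcup_k F (Negz k)))).
  by move=> x [[k|k] Nk]; [left|right]; exists k.
by apply: lebesgue_nullU; exact: lebesgue_null_bigcup.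
Qed.

Lemma lebesgue_null_of_unit_interval N :
  (forall k : int,
     lebesgue_null [set x | N (x + k%:~R) /\ 0 <= x < 1]) ->
  lebesgue_null N.
Proof.
move=> N0.
apply: (@lebesgue_null_subset [set x | exists k : int,
    N (x - k%:~R + k%:~R) /\ 0 <= x - k%:~R < 1]).
  move=> x Nx; exists (Num.floor x); rewrite subrK; split => //.
  rewrite subr_ge0 floor_le /= ltrBlDr addrC.
  by rewrite -[X in _ + X]/(1%:~R) -intrD floorD1_gt.
by apply: lebesgue_null_bigcup_int => k; exact: (lebesgue_null_shift (- k%:~R) (N0 k)).
Qed.

End null_sets.

Section square_integrable_decay.
Variable R : realType.
Local Notation mu := (@lebesgue_measure R).
Local Notation cmu := (@completed_lebesgue_measure R).

(** The topology on complex numbers is that of the norm with values in R[i], hence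
the passage through complex radii. *)
Lemma open_normc_gt (e : R) : open ([set z | e < normc z] : set R[i]^o).
Proof.
rewrite openE => z /= ez; apply/nbhs_ballP => /=.
exists ((normc z - e)%:C)%C; first by rewrite /= ltcE /= eqxx subr_gt0.
move=> w; rewrite /ball /= ltcE /= => /andP[_ zw].
have zwe : normc (z - w : R[i]) + e < normc (z : R[i]).
  by rewrite -ltrBrDr; exact: zw.
have := lt_le_trans zwe (_ : normc (z : R[i]) <= normc (z - w : R[i]) + normc (w : R[i])).
rewrite ltrD2l; apply.
by have := le_normcD (z - w : R[i]) w; rewrite subrK.
Qed.

(** Chebyshev's inequality, from the simple function e^2 1_D below |f|^2. *)
Lemma L2_level_set_fin (f : R -> R[i]) (e : R) : in_L2 f -> 0 < e ->
  (cmu [set x | (e < normc (f x))%R] < +oo)%E.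
Proof.
move=> [mf intf] e0; set D := [set x | _].
have mD : measurable (D : set (lebesgue_space R)).
  by have := mf _ (@open_normc_gt e); rewrite /preimage.
have e20 : 0 <= e ^+ 2 by rewrite sqr_ge0.
have le : (((e ^+ 2)%:E * cmu D) <=
    \int[cmu]_x ((normc (f x)) ^+ 2)%:E)%E.
  rewrite ge0_integralTE; last by move=> x; rewrite lee_fin sqr_ge0.
  apply: ereal_sup_ubound => /=.
  exists (scale_nnsfun (indic_nnsfun R mD) e20).
    move=> x /=; rewrite lee_fin mindicE.
    case: (boolP (x \in D)); last by rewrite mulr0 sqr_ge0.
    rewrite inE mulr1 /D /= => ex.
    by rewrite lerXn2r// ?nnegrE ltW// (lt_trans e0).
  by rewrite sintegralrM sintegral_indic.
have := le_lt_trans le intf.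
apply: contraTT; rewrite -!leNgt !leye_eq => /eqP ->.
by rewrite gt0_muley// lte_fin exprn_gt0.
Qed.

(** Borel-Cantelli: the measures of the pieces of D in [k, k+1) sum to at most the
measure of D.  D is first enlarged to a G-delta set of the same measure, whose
pieces can be translated as Borel sets. *)
Lemma finite_measure_eventually_avoided (D : set R) : (cmu D < +oo)%E ->
  lebesgue_null [set x | 0 <= x < 1 /\
    forall n : nat, exists k : int, (n <= `|k|)%N /\ D (x + k%:~R)].
Proof.
move=> Dfin.
have [G [oG DG muG]] := outer_measure_Gdelta D.
set B := \bigcap_i G i in DG muG.
have mB : measurable B.
  by apply: bigcapT_measurable => i; exact: open_measurable.
pose I (k : int) : set R := [set x | k%:~R <= x < k%:~R + 1].
have mI k : measurable (I k).
  have -> : I k = `[k%:~R, (k%:~R + 1)[%classic by apply/seteqP; split => x /=; rewrite in_itv.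
  exact: measurable_itv.
have tI : trivIset setT I.
  apply/trivIsetP => i j _ _ ij; apply/seteqP; split => // x [/= /andP[ix xi] /andP[jx xj]].
  have : i < j + 1 by rewrite -(ltr_int R) intrD (le_lt_trans ix).
  have : j < i + 1 by rewrite -(ltr_int R) intrD (le_lt_trans jx).
  by rewrite !ltzD1 => ji ij'; move: ij; rewrite eq_le ij' ji.
pose E k : set R := (fun x => x + (k%:~R : R)) @^-1` (B `&` I k).
pose F (n : nat) := E (Posz n) `|` E (- Posz n).
have mE k : measurable (E k).
  have := @measurable_preimage_affine R 1 k%:~R _ (measurableI _ _ mB (mI k)).
  by congr measurable; apply/seteqP; split => x /=; rewrite mul1r.
have muE k : mu (E k) = mu (B `&` I k).
  by apply: lebesgue_measure_shift; exact: (measurableI _ _ mB (mI k)).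
have mF n : measurable (F n) by exact: measurableU.
exists (lim_sup_set F); split.
- rewrite /lim_sup_set; apply: bigcapT_measurable => n.
  by apply: bigcup_measurable => k _; exact: mF.
- apply: (lim_sup_set_cvg0 (mu := mu)) => //.
  have half (h : nat -> int) : injective h ->
      (\sum_(n <oo) mu (B `&` I (h n)) < +oo)%E.
    move=> injh.
    rewrite [ltLHS](_ : _ = mu (\bigcup_n (B `&` I (h n)))); last first.
      rewrite measure_bigcup//=.
      - by apply: eq_eseriesl => n; rewrite in_setT.
      - by move=> n _; exact: (measurableI _ _ mB (mI _)).
      - apply/trivIsetP => i j _ _ ij.
        have /trivIsetP/(_ (h i) (h j) Logic.I Logic.I) := tI.
        rewrite (inj_eq injh) => /(_ ij) Iij.
        by rewrite setIACA setIid Iij setI0.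
    rewrite (le_lt_trans _ Dfin)// -[leRHS]muG.
    by apply: (le_outer_measure ((@wlength R idfun)^*)%mu) => x [n _ []].
  have lhs : (\sum_(n <oo) mu (F n) <=
      \sum_(n <oo) (mu (B `&` I (Posz n)) + mu (B `&` I (- Posz n)%R)))%E.
    apply: lee_nneseries => [n _ _|n _]; first exact: measure_ge0.
    by rewrite -!muE; exact: (@measureU2 _ _ _ mu _ _ (mE _) (mE _)).
  apply: (le_lt_trans lhs); rewrite nneseriesD//.
  apply: lte_add_pinfty; apply: half; first by move=> i j [].
  by move=> i j /oppr_inj [].
- move=> x [x01 xD] n _; have [k [nk Dk]] := xD n.
  have Ek : E k x.
    by split; [exact: DG|rewrite /I /= addrC lerDl ltrD2l].
  exists `|k|%N => //=; rewrite /F.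
  by case: (intP k) Ek => [|m|m] Ek; [left|left|right]; rewrite ?abszN.
Qed.

Global Instance int_infty_filter : Filter int_infty.
Proof.
apply: filter_from_filter; first by exists 0%N.
move=> i j _ _; exists (maxn i j) => //= k /=.
by rewrite geq_max => /andP[].
Qed.

(** [finite_measure_eventually_avoided], applied to the level sets |f| > 1/(m+1). *)
Lemma minimal_decay_in_L2 (f : R -> R[i]) : in_L2 f -> minimal_decay f.
Proof.
move=> fL2; apply/lebesgue_aeE; apply: lebesgue_null_of_unit_interval => k.
pose D (m : nat) := [set x | m.+1%:R^-1 < normc (f x)].
apply: (@lebesgue_null_subset _ (\bigcup_m [set x | 0 <= x < 1 /\
    forall n : nat, exists k : int, (n <= `|k|)%N /\ D m (x + k%:~R)])); last first.
  apply: lebesgue_null_bigcup => m; apply: finite_measure_eventually_avoided.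
  exact: L2_level_set_fin.
move=> x [nxk x01]; apply: contrapT => nD; apply: nxk.
apply/cvgrPdist_lt => e e0.
have [m me] : exists m : nat, m.+1%:R^-1 < e.
  have [m _ /(_ m (leqnn _))] := near_infty_natSinv_lt (PosNum e0).
  by exists m.
have [n Hn] : exists n : nat, forall j : int, (n <= `|j|)%N -> ~ D m (x + j%:~R).
  apply: contrapT => H; apply: nD; exists m => //; split => // n.
  apply: contrapT => H'; apply: H; exists n => j nj Dj; apply: H'.
  by exists j.
exists (n + `|k|)%N => // j /= nj.
rewrite sub0r normrN ger0_norm; last by case: (f _) => a b; rewrite sqrtr_ge0.
have : ~ D m (x + (k + j)%:~R).
  apply: Hn; have : (`|j| <= `|(k + j)%R| + `|k|)%N.
    have := leqD_dist (k + j) 0 k; rewrite subr0 sub0r abszN addrAC subrr add0r.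
    by [].
  lia.
by move/negP; rewrite -leNgt intrD addrA => /le_lt_trans; apply.
Qed.
End square_integrable_decay.

(** * The exponential on the unit circle *)

Section unit_circle.
Variable R : realType.
Implicit Types (a b t : R) (z w : R[i]).

Lemma cexpiD a b : cexpi (a + b) = cexpi a * cexpi b.
Proof. by apply/eqP; rewrite eq_complex /= cosD sinD !eqxx /= addrC. Qed.

Lemma cexpi0 : cexpi (0 : R) = 1.
Proof. by rewrite /cexpi cos0 sin0. Qed.

Lemma normc_cexpi a : normc (cexpi a) = 1.
Proof. by rewrite /normc /= cos2Dsin2 sqrtr1. Qed.

Lemma cexpi_int (k : int) : cexpi (2 * pi * k%:~R : R) = 1.
Proof.
have nat_case (n : nat) : cexpi (2 * pi * n%:R : R) = 1.
  elim: n => [|n IHn]; first by rewrite mulr0 cexpi0.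
  rewrite -(natr1 n) mulrDr mulr1 cexpiD IHn mul1r /cexpi.
  by rewrite (_ : 2 * pi = pi *+ 2) ?mulr_natl// cos2pi sin2pi.
case: k => k; first exact: nat_case.
have := cexpiD (2 * pi * k.+1%:R) (2 * pi * (Negz k)%:~R).
by rewrite nat_case NegzE mulrNz mulrN mul1r => <-; rewrite subrr cexpi0.
Qed.

Lemma cexpi_period t (k : int) : cexpi (2 * pi * (t + k%:~R)) = cexpi (2 * pi * t).
Proof. by rewrite mulrDr cexpiD cexpi_int mulr1. Qed.

Lemma normc_cexpi_sub1 a : normc (cexpi a - 1) = 2 * `|sin (a / 2)|.
Proof.
rewrite /normc /cexpi /= oppr0 addr0.
have -> : (cos a - 1) ^+ 2 + sin a ^+ 2 = (2 * `|sin (a / 2)|) ^+ 2.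
  rewrite exprMn real_normK ?num_real// sin2cos2.
  have -> : cos a = cos (a / 2) ^+ 2 *+ 2 - 1.
    by rewrite -cos_mulr2n; congr cos; rewrite -mulr_natr; field.
  rewrite sin2cos2; ring.
by rewrite sqrtr_sqr ger0_norm// mulr_ge0.
Qed.

Lemma sin_mvt a : 0 <= a -> exists2 c, 0 <= c <= a & sin a = cos c * a.
Proof.
move=> a0.
have [|c + sac] := @MVT_segment R sin cos 0 a a0 (fun x _ => is_derive_sin x).
  exact/continuous_subspaceT/continuous_sin.
by rewrite in_itv /= => ?; exists c => //; move: sac; rewrite sin0 !subr0.
Qed.

Lemma norm_sin_le a : `|sin a| <= `|a|.
Proof.
wlog a0 : a / 0 <= a => [hw|].
  have [/hw//|/ltW] := leP 0 a; rewrite -oppr_ge0 => /hw.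
  by rewrite sinN !normrN.
have [c _ ->] := sin_mvt a0; rewrite normrM ler_piMl//; exact: cos_max.
Qed.

Lemma sin_ge_linear a : 0 <= a <= 1 -> cos 1 * a <= sin a.
Proof.
move=> /andP[a0 a1]; have [c /andP[c0 ca] ->] := sin_mvt a0.
rewrite ler_wpM2r//.
have pi1 : 1 <= pi :> R by rewrite (le_trans _ (pi_ge2 _))// ler1n.
have c1 := le_trans ca a1.
by rewrite leNgt ltr_cos ?in_itv/= ?ler01 ?pi1 ?c0 ?(le_trans c1 pi1)// -leNgt.
Qed.

Lemma normc_cexpi_sub1_le a : normc (cexpi a - 1) <= `|a|.
Proof.
rewrite normc_cexpi_sub1 (le_trans (ler_wpM2l _ (norm_sin_le _)))//.
rewrite normrM [`|2^-1|]ger0_norm ?invr_ge0// mulrCA divff ?mulr1//.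
Qed.

(** The chord |e(t) - 1| = 2 |sin (pi t)| dominates the distance from t to 0; the
constant cos 1 comes from the mean value theorem on [0, 1], beyond which the
sine is increasing up to pi / 2. *)
Lemma normc_cexpi_sub1_ge t : `|t| <= 1 / 2 ->
  cos 1 * `|t| <= normc (cexpi (2 * pi * t) - 1).
Proof.
rewrite normc_cexpi_sub1 (_ : 2 * pi * t / 2 = pi * t); last by field.
wlog t0 : t / 0 <= t => [hw|].
  have [/hw//|/ltW] := leP 0 t; rewrite -oppr_ge0 => /hw.
  by rewrite mulrN sinN !normrN.
rewrite (ger0_norm t0) => t2.
have cos10 : 0 < cos 1 :> R := cos1_gt0 R.
have cos11 : cos 1 <= 1 :> R := cos_le1 1.
have pi2 := pi_ge2 R.
have pt0 : 0 <= pi * t by rewrite mulr_ge0// pi_ge0.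
have [pt1|pt1] := leP (pi * t) 1.
  have s := sin_ge_linear (introT andP (conj pt0 pt1)).
  have ct0 : 0 <= cos 1 * t by rewrite mulr_ge0// ltW.
  rewrite ger0_norm ?(le_trans _ s) ?mulr_ge0 ?(ltW cos10)//; nra.
have s1 : cos 1 <= sin 1 :> R.
  by have := @sin_ge_linear 1; rewrite mulr1 ler01 lexx; apply.
have : sin 1 < sin (pi * t).
  rewrite ltr_sin// in_itv /=; nra.
move=> st; rewrite ger0_norm; first by nra.
by rewrite ltW// (le_lt_trans _ st)// (le_trans _ s1)// ltW.
Qed.

Lemma cexpi_eq1 t : cexpi (2 * pi * t) = 1 -> exists k : int, t = k%:~R.
Proof.
move=> et; have /andP[fl ge] := floor_itv (t + 1 / 2).
set k := Num.floor _ in fl ge; exists k; apply/eqP; rewrite -subr_eq0 -normr_eq0.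
have := @normc_cexpi_sub1_ge (t - k%:~R).
have -> : cexpi (2 * pi * (t - k%:~R)) = 1.
  by rewrite -[t - _]/(t + - (k%:~R)) -mulrNz cexpi_period.
rewrite subrr normc0 => H.
have {}H : cos 1 * `|t - k%:~R| <= 0.
  by apply: H; rewrite ler_norml; move: fl ge; rewrite intrD; lra.
rewrite eq_le normr_ge0 andbT -(pmulr_rle0 _ (cos1_gt0 R)) //.
Qed.

End unit_circle.

(** * Trigonometric binomials and trinomials *)

Section level_sets.
Variable R : realType.
Implicit Types (z w A B C : R[i]) (alpha beta x : R).

Lemma normc_sqr z : normc z ^+ 2 = complex.Re z ^+ 2 + complex.Im z ^+ 2.
Proof. by case: z => a b; rewrite /= sqr_sqrtr// addr_ge0 ?sqr_ge0. Qed.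

Lemma normc_ge0 z : 0 <= normc z.
Proof. by case: z => a b; rewrite sqrtr_ge0. Qed.

Lemma normc_eq0 z : (normc z == 0) = (z == 0).
Proof. by apply/eqP/eqP => [/eq0_normc|->]//; rewrite normc0. Qed.

Lemma lebesgue_null_set1 x : lebesgue_null [set x].
Proof.
exists [set x]; split => //; exact: lebesgue_measure_set1.
Qed.

(** A fiber is a coset of the group of integer multiples of 1 / alpha. *)
Lemma cexpi_fiber_null alpha w : alpha != 0 ->
  lebesgue_null [set x | cexpi (2 * pi * alpha * x) = w].
Proof.
move=> a0.
have [[x0 wx0]|nw] := pselect (exists x, cexpi (2 * pi * alpha * x) = w); last first.
  apply: (@lebesgue_null_subset _ set0); last exact: negligible_set0.
  by move=> x xw; apply: nw; exists x.
apply: (@lebesgue_null_subset _ [set x | exists k : int,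
   [set x0 + k%:~R / alpha] x]); last first.
  by apply: lebesgue_null_bigcup_int => k; exact: lebesgue_null_set1.
move=> x /= xw.
have : cexpi (2 * pi * (alpha * (x - x0))) = 1.
  have := cexpiD (2 * pi * alpha * x0) (2 * pi * alpha * (x - x0)).
  rewrite -mulrDr [x0 + _]addrC subrK xw wx0 mulrA => /esym.
  have w0 : w != 0 by rewrite -normc_eq0 -wx0 normc_cexpi oner_eq0.
  by move=> /(congr1 (fun z => w^-1 * z)); rewrite mulrA mulVf// mul1r.
move/cexpi_eq1 => [k kE]; exists k; rewrite -kE mulrAC mulfV// mul1r.
by rewrite addrC subrK.
Qed.

(** A circle centred at 0 meets a vertical line in two conjugate points at most. *)
Lemma normc_sum_conj z w : normc z = normc w -> complex.Re z = complex.Re w ->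
  w = z \/ w = (z^*)%C.
Proof.
case: z w => [a b] [c d] n /= ac; rewrite ac.
have /(congr1 (fun t => t ^+ 2)) := n; rewrite !normc_sqr /= ac => /addrI /eqP.
by rewrite eqf_sqr => /orP[] /eqP ->; [left|right]; rewrite ?opprK.
Qed.

(** Prescribing the modulus of A + B e(alpha x) prescribes the real part of
conj(A) B e(alpha x), whose modulus is fixed, so e(alpha x) takes at most two
values. *)
Lemma binomial_level_null A B alpha (r : R) :
  A != 0 -> B != 0 -> alpha != 0 ->
  lebesgue_null [set x | normc (A + B * cexpi (2 * pi * alpha * x)) = r].
Proof.
move=> A0 B0 a0; set E := [set x | _].
have [[x0 Ex0]|nE] := pselect (exists x, E x); last first.
  apply: (@lebesgue_null_subset _ set0); last exact: negligible_set0.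
  by move=> x xE; apply: nE; exists x.
pose D := (A^*)%C * B.
have D0 : D != 0.
  rewrite mulf_neq0// -normc_eq0.
  by case: (A) A0 => a b; rewrite -normc_eq0 /= sqrrN.
pose e x : R[i] := cexpi (2 * pi * alpha * x).
have sq x : normc (A + B * e x) ^+ 2 = normc A ^+ 2 + normc B ^+ 2 + complex.Re (D * e x) *+ 2.
  have := normc_cexpi (2 * pi * alpha * x); rewrite -/(e x) /D.
  case: (A) (B) (e x) => [a b] [c d] [u v] uv.
  have {}uv : u ^+ 2 + v ^+ 2 = 1.
    by have /(congr1 (fun t => t ^+ 2)) := uv; rewrite normc_sqr /= expr1n.
  rewrite !normc_sqr /=.
  transitivity (a ^+ 2 + b ^+ 2 + (c ^+ 2 + d ^+ 2) * (u ^+ 2 + v ^+ 2) +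
    ((a * c - - b * d) * u - (a * d + - b * c) * v) *+ 2); first by ring.
  by rewrite uv mulr1.
apply: (@lebesgue_null_subset _ ([set x | e x = D * e x0 / D] `|`
    [set x | e x = ((D * e x0)^*)%C / D])).
  move=> x Ex.
  have /normc_sum_conj : normc (D * e x0) = normc (D * e x).
    by rewrite !normcM !normc_cexpi.
  have ReE : complex.Re (D * e x0) = complex.Re (D * e x).
    have : normc (A + B * e x0) ^+ 2 = normc (A + B * e x) ^+ 2.
      by rewrite /e Ex Ex0.
    by rewrite !sq => /addrI /eqP; rewrite eqrMn2r => /eqP.
  move=> /(_ ReE) [] <-; [left|right]; by rewrite /= mulrAC mulfV// mul1r.
by apply: lebesgue_nullU; exact: cexpi_fiber_null.
Qed.

Lemma binomial_zero_null A B alpha : (A != 0) || (B != 0) -> alpha != 0 ->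
  lebesgue_null [set x | A + B * cexpi (2 * pi * alpha * x) = 0].
Proof.
move=> AB a0; have [B0|B0] := eqVneq B 0.
  apply: (@lebesgue_null_subset _ set0); last exact: negligible_set0.
  move=> x /eqP; rewrite B0 mul0r addr0.
  by move: AB; rewrite B0 eqxx orbF => /negP.
have [A0|A0] := eqVneq A 0.
  apply: (@lebesgue_null_subset _ set0); last exact: negligible_set0.
  move=> x /eqP; rewrite A0 add0r mulf_eq0 (negPf B0) /=.
  by rewrite -normc_eq0 normc_cexpi oner_eq0.
apply: lebesgue_null_subset (binomial_level_null 0 A0 B0 a0).
by move=> x /= ->; rewrite normc0.
Qed.

End level_sets.

Section trinomials.
Variable R : realType.
Implicit Types (z w A B C : R[i]) (alpha beta x : R).

Definition trinom A B C alpha beta x : R[i] :=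
  A + B * cexpi (2 * pi * alpha * x) + C * cexpi (2 * pi * beta * x).

(** At a zero, |A + B e(alpha x)| = |C|; if A or B vanishes the trinomial is a
binomial up to a unimodular factor. *)
Lemma trinom_zero_null A B C alpha beta :
  alpha != 0 -> beta != 0 -> alpha != beta ->
  [|| A != 0, B != 0 | C != 0] ->
  lebesgue_null [set x | trinom A B C alpha beta x = 0].
Proof.
move=> a0 b0 ab ABC.
have [A0|A0] := eqVneq A 0; last first.
  have [B0|B0] := eqVneq B 0.
    have := @binomial_zero_null R A C beta; rewrite A0 => /(_ isT b0).
    by apply: lebesgue_null_subset => x /=; rewrite /trinom B0 mul0r addr0.
  apply: lebesgue_null_subset (binomial_level_null (normc C) A0 B0 a0).
  move=> x /= /eqP; rewrite addr_eq0 => /eqP ->.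
  by rewrite normcN normcM normc_cexpi mulr1.
have BC : (B != 0) || (C != 0) by move: ABC; rewrite A0 eqxx.
have ba : beta - alpha != 0 by rewrite subr_eq0 eq_sym.
apply: lebesgue_null_subset (binomial_zero_null BC ba) => x /= /eqP.
rewrite /trinom A0 add0r.
have -> : 2 * pi * beta * x = 2 * pi * alpha * x + 2 * pi * (beta - alpha) * x by ring.
rewrite cexpiD mulrCA [B * _]mulrC -mulrDr mulf_eq0 -normc_eq0 normc_cexpi oner_eq0 /=.
by move/eqP.
Qed.

Lemma trinom_shift A B C alpha beta x y :
  trinom A B C alpha beta (x + y) =
  trinom A (B * cexpi (2 * pi * alpha * y)) (C * cexpi (2 * pi * beta * y)) alpha beta x.
Proof. by rewrite /trinom !mulrDr !cexpiD; ring. Qed.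

Lemma trinom_swap A B C alpha beta x :
  trinom A B C alpha beta x = trinom A C B beta alpha x.
Proof. by rewrite /trinom addrAC. Qed.

Lemma continuous_normc_trinom A B C alpha beta :
  continuous (fun x => normc (trinom A B C alpha beta x)).
Proof.
pose c (a : R) x := cos (2 * pi * a * x).
pose s (a : R) x := sin (2 * pi * a * x).
have cc a : continuous (c a).
  move=> x; apply: (@continuous_comp _ _ _ ( *%R (2 * pi * a)) cos).
    exact: mulrl_continuous.
  exact: continuous_cos.
have cs a : continuous (s a).
  move=> x; apply: (@continuous_comp _ _ _ ( *%R (2 * pi * a)) sin).
    exact: mulrl_continuous.
  exact: continuous_sin.
pose h x :=
   (complex.Re A + (complex.Re B * c alpha x - complex.Im B * s alpha x) +
      (complex.Re C * c beta x - complex.Im C * s beta x)) ^+ 2 +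
   (complex.Im A + (complex.Re B * s alpha x + complex.Im B * c alpha x) +
      (complex.Re C * s beta x + complex.Im C * c beta x)) ^+ 2.
have -> : (fun x => normc (trinom A B C alpha beta x)) = Num.sqrt \o h.
  by apply/funext => x; rewrite /trinom /h /=; case: (A) (B) (C) => [? ?] [? ?] [? ?].
move=> x; apply: (@continuous_comp _ _ _ h Num.sqrt); last exact: sqrt_continuous.
rewrite /h.
have cM (k : R) (f : R -> R) : {for x, continuous f} -> {for x, continuous (fun y => k * f y)}.
  by move=> cf; apply: (@continuousM _ _ (cst k) f) => //; exact: cst_continuous.
have cD (f g : R -> R) : {for x, continuous f} -> {for x, continuous g} ->
   {for x, continuous (fun y => f y + g y)} by exact: continuousD.
have cB (f g : R -> R) : {for x, continuous f} -> {for x, continuous g} ->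
   {for x, continuous (fun y => f y - g y)} by exact: continuousB.
have cX (f : R -> R) : {for x, continuous f} -> {for x, continuous (fun y => f y ^+ 2)}.
  by move=> cf; exact: (@continuousM _ _ f f).
have cc0 (k : R) : {for x, continuous (fun _ : R => k)} by exact: cst_continuous.
apply: (cD); apply: (cX); apply: (cD); [apply: (cD)| |apply: (cD)|].
- exact: cc0.
- by apply: (cB); apply: (cM); [exact: cc|exact: cs].
- by apply: (cB); apply: (cM); [exact: cc|exact: cs].
- exact: cc0.
- by apply: (cD); apply: (cM); [exact: cs|exact: cc].
- by apply: (cD); apply: (cM); [exact: cs|exact: cc].
Qed.

End trinomials.

(** * Simultaneous integer approximation *)

Section diophantine.
Variable R : realType.
Implicit Types (x theta : R).

Lemma dist_int_lt x (r : R) : dist_int x < r -> exists m : int, `|x - m%:~R| < r.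
Proof.
move=> /inf_lt[]; first by exists `|x - 0%:~R|, 0.
by move=> _ [m _ <-] ?; exists m.
Qed.

(** Pigeonhole: two of the N + 1 fractional parts of 0, x, ..., N x fall in the same
of the N intervals of length 1 / N. *)
Lemma dirichlet_approximation x (N : nat) : (0 < N)%N ->
  exists k : nat, (0 < k <= N)%N /\
    exists m : int, `|k%:R * x - m%:~R| * N%:R < 1.
Proof.
move=> N0; have N0r : 0 < N%:R :> R by rewrite ltr0n.
pose fr (i : nat) : R := i%:R * x - (Num.floor (i%:R * x))%:~R.
have fr01 i : 0 <= fr i < 1.
  rewrite subr_ge0 floor_le /= ltrBlDr addrC.
  by rewrite -[X in _ + X]/(1%:~R) -intrD floorD1_gt.
have fr0 i : 0 <= N%:R * fr i by have /andP[? _] := fr01 i; rewrite mulr_ge0.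
have bucket_lt (i : 'I_N.+1) : (Num.truncn (N%:R * fr i) < N)%N.
  by rewrite truncn_lt_nat//; have /andP[_ ?] := fr01 i; rewrite gtr_pMr.
pose bucket (i : 'I_N.+1) : 'I_N := Ordinal (bucket_lt i).
have /injectivePn [i [j ij bij]] : ~~ injectiveb bucket.
  by apply/negP => /injectiveP /leq_card; rewrite !card_ord ltnn.
wlog lt_ij : i j ij bij / (i < j)%N => [hw|].
  have [/hw|/hw] : (i < j)%N \/ (j < i)%N.
  - by apply/orP; rewrite -neq_ltn.
  - exact.
  - by apply => //; rewrite eq_sym.
exists (j - i)%N; split; first by have := ltn_ord j; lia.
exists (Num.floor (j%:R * x) - Num.floor (i%:R * x)).
have -> : (j - i)%:R * x - (Num.floor (j%:R * x) - Num.floor (i%:R * x))%:~R =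
  fr j - fr i by rewrite natrB ?(ltnW lt_ij)// rmorphB /fr /=; ring.
rewrite -[N%:R in X in X < _]ger0_norm// -normrM mulrC mulrBr.
have /andP[li ui] := truncn_itv (fr0 i).
have /andP[lj uj] := truncn_itv (fr0 j).
have /(congr1 val) /= bE := bij; rewrite bE in li ui.
rewrite ltr_norml; move: li ui lj uj; rewrite -!natr1; lra.
Qed.

(** There are finitely many k, and each k x is at positive distance from the integers. *)
Lemma irrational_multiples_away x (N : nat) :
  (forall (n : nat) (m : int), (0 < n)%N -> n%:R * x != m%:~R) ->
  exists M : nat, (0 < M)%N /\ forall k : nat, (0 < k < N)%N ->
    forall m : int, 1 <= `|k%:R * x - m%:~R| * M%:R.
Proof.
move=> irr.
elim: N => [|N [M [M0 HM]]]; first by exists 1%N; split=> // k; lia.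
have [N0|N0] := posnP N; first by exists 1%N; split=> // k; lia.
pose fl := Num.floor (N%:R * x).
have f0 : N%:R * x != fl%:~R by exact: irr.
have f1 : N%:R * x != (fl + 1)%:~R.
  by exact: irr.
have /andP[fl1 fl2] := floor_itv (N%:R * x); rewrite -/fl in fl1 fl2.
pose d := Num.min (N%:R * x - fl%:~R) ((fl + 1)%:~R - N%:R * x).
have d0 : 0 < d.
  by rewrite lt_min !subr_gt0 fl2 lt_neqAle eq_sym f0 fl1.
exists (maxn M (Num.truncn d^-1).+1); split; first by lia.
move=> k kN m; have [kN'|/eqP kN'] := eqVneq k N; last first.
  apply: (le_trans (HM k _ m)); first by lia.
  by rewrite ler_wpM2l// ler_nat leq_maxl.
have dm : d <= `|k%:R * x - m%:~R|.
  rewrite kN' ge_min; have [mfl|mfl] := leP m fl.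
    rewrite ger0_norm ?subr_ge0; last by rewrite (le_trans _ fl1)// ler_int.
    by rewrite lerD2l lerN2 ler_int mfl.
  rewrite ler0_norm ?subr_le0 ?opprB; last first.
    by rewrite (le_trans (ltW fl2))// ler_int lezD1.
  by rewrite lerD2r ler_int lezD1 mfl orbT.
have : 1 <= d * (maxn M (Num.truncn d^-1).+1)%:R.
  rewrite -ler_pdivrMl// mulr1 ltW// (lt_le_trans (truncnS_gt _))//.
  by rewrite ler_nat leq_maxr.
by move/le_trans; apply; rewrite ler_wpM2r.
Qed.

(** For irrational x, Dirichlet's approximation with a large bound cannot be
attained by a small multiple; for rational x, multiples of the denominator do. *)
Lemma dirichlet_infinitely_often x (N : nat) :
  exists n : nat, [/\ (N <= n)%N, (0 < n)%N &
    exists m : int, n%:R * `|n%:R * x - m%:~R| <= 1].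
Proof.
have [[n [n0 [m nm]]]|irr] := pselect (exists n : nat, (0 < n)%N /\
    exists m : int, n%:R * x = m%:~R).
  exists (n * N.+1)%N; split; [by nia|by nia|].
  exists (m * Posz N.+1); rewrite [X in _ * `|X * _ - _|]natrM [X in _ * `|X - _|]mulrAC nm.
  by rewrite intrM -pmulrn subrr normr0 mulr0.
have [|M [M0 HM]] := @irrational_multiples_away x N.
  by move=> n m n0; apply/eqP => E; apply: irr; exists n; split=> //; exists m.
pose N' := (maxn M N).+1.
have [k [kN' [m km]]] := @dirichlet_approximation x N' isT.
have kN : (N <= k)%N.
  rewrite leqNgt; apply/negP => kN; have := HM k _ m.
  have -> : (0 < k < N)%N by lia.
  move=> /(_ isT); apply/negP; rewrite -ltNge (le_lt_trans _ km)//.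
  by rewrite ler_wpM2l// ler_nat /N'; lia.
exists k; split=> //; first by lia.
exists m; rewrite mulrC (le_trans _ (ltW km))// ler_wpM2l// ler_nat.
by lia.
Qed.

Lemma limn_einf_frequently (u : nat -> R) :
  (limn_einf (fun n => (u n)%:E) < +oo)%E ->
  exists L : R, forall N : nat, exists2 n, (N <= n)%N & u n < L.
Proof.
move=> uoo.
have [L supL] : exists L : R,
    (ereal_sup (range (einfs (fun n => (u n)%:E))) < L%:E)%E.
  have limE : limn (einfs (fun n => (u n)%:E)) =
      ereal_sup (range (einfs (fun n => (u n)%:E))).
    by apply/cvg_lim => //; exact: cvg_einfs_sup.
  move: uoo; rewrite limn_einf_lim limE.
  case: ereal_sup => [r _|//|_]; last by exists 0; rewrite ltNyr.
  by exists (r + 1); rewrite lte_fin ltrDl.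
exists L => N.
have : (einfs (fun n => (u n)%:E) N < L%:E)%E.
  by apply: le_lt_trans supL; apply: ereal_sup_ubound; exists N.
by move=> /ereal_inf_lt [_ [n /= Nn <-]]; rewrite lte_fin; exists n.
Qed.

End diophantine.

(** * Approximation by reduced fractions, and harmonic sums *)

Section coprime.
Variable R : realType.
Implicit Types (rho gamma L : R).

(** Dividing n and m by their gcd only improves the approximation, and the reduced
denominators are unbounded since rho is irrational. *)
Lemma coprime_approximation rho gamma L :
  1 < gamma ->
  (forall (n : nat) (m : int), (0 < n)%N -> n%:R * rho != m%:~R) ->
  (forall N : nat, exists2 n : nat, (N <= n)%N &
     exists m : int, n%:R `^ gamma * `|n%:R * rho - m%:~R| < L) ->
  forall N : nat, exists n : nat, [/\ (N <= n)%N, (0 < n)%N &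
     exists m : int, coprimez n m /\ n%:R `^ gamma * `|n%:R * rho - m%:~R| < L].
Proof.
move=> g1 irr app N.
have [M [M0 HM]] := irrational_multiples_away N irr.
have [n nN [m nm]] := app (Num.truncn (L * M%:R)).+1.
have nLM : L * M%:R < n%:R.
  by rewrite (lt_le_trans (truncnS_gt _))// ler_nat.
have n0 : (0 < n)%N by lia.
pose g := gcdz n m.
have g0 : g != 0 by rewrite gcdz_eq0; lia.
have gn : (gcdn n `|m| %| n)%N by exact: dvdn_gcdl.
pose n' := (n %/ gcdn n `|m|)%N.
pose m' := (m %/ g)%Z.
have gpos : (0 < gcdn n `|m|)%N by rewrite gcdn_gt0 n0.
have nE : n = (n' * gcdn n `|m|)%N by rewrite /n' divnK.
have mE : m = m' * g by rewrite /m' divzK// dvdz_gcdr.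
have gE : g = Posz (gcdn n `|m|) by [].
have n'0 : (0 < n')%N by move: n0; rewrite {1}nE muln_gt0 => /andP[].
have cop : coprimez n' m'.
  have mg : `|m|%N = (`|m'| * gcdn n `|m|)%N by rewrite {1}mE abszM.
  have : (gcdn n' `|m'| * gcdn n `|m| = 1 * gcdn n `|m|)%N.
    by rewrite muln_gcdl -mg -nE mul1n.
  by move/eqP; rewrite eqn_pmul2r// => /eqP E; rewrite /coprimez /gcdz /= E.
have le1 : `|n'%:R * rho - m'%:~R| <= `|n%:R * rho - m%:~R|.
  rewrite mE [in leRHS]nE natrM intrM gE -!pmulrn mulrAC -mulrBl normrM.
  by rewrite ler_peMr// normr_nat ler1n.
have pow : n'%:R `^ gamma <= n%:R `^ gamma :> R.
  by rewrite ge0_ler_powR ?nnegrE ?(le_trans ler01 (ltW g1))// ler_nat nE leq_pmulr.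
exists n'; split=> //.
  rewrite leqNgt; apply/negP => n'N; have := HM n' _ m'; rewrite n'0 n'N => /(_ isT).
  apply/negP; rewrite -ltNge (le_lt_trans (ler_wpM2r _ le1))//.
  have nn : n%:R <= n%:R `^ gamma :> R.
    by rewrite -[leLHS]powRr1// ler_powR ?(ltW g1)// ler1n.
  have pn : 0 < n%:R :> R by rewrite ltr0n.
  have M0r : 0 < M%:R :> R by rewrite ltr0n.
  rewrite -(ltr_pM2l pn) mulr1 mulrA (lt_trans _ nLM)// ltr_pM2r//.
  by rewrite (le_lt_trans _ nm)// ler_wpM2r.
exists m'; split=> //; rewrite (le_lt_trans _ nm)// ler_pM// powR_ge0.
Qed.

End coprime.

Section harmonic_numbers.
Variable R : realType.

Definition harmonic_sum (n : nat) : R := \sum_(1 <= j < n) j%:R^-1.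

Lemma harmonic_sum_ge0 n : 0 <= harmonic_sum n.
Proof. by apply: sumr_ge0 => i _; rewrite invr_ge0. Qed.

Lemma harmonic_sum_le_ln n : (0 < n)%N -> harmonic_sum n <= 1 + ln n%:R.
Proof.
have strong k : harmonic_sum k.+2 <= 1 + ln k.+1%:R.
  elim: k => [|k IHk]; first by rewrite /harmonic_sum big_nat1 invr1 ln1 addr0.
  rewrite /harmonic_sum big_nat_recr//=; apply: (le_trans (lerD IHk (lexx _))).
  rewrite -addrA lerD2l -lerBrDl -opprB lerNr -ln_div ?posrE ?ltr0n//.
  have -> : k.+1%:R / k.+2%:R = 1 - k.+2%:R^-1 :> R.
    by rewrite -{1}[k.+1%:R](addrK 1) natr1 mulrBl mul1r divff// pnatr_eq0.
  by apply: le_ln1Dx; rewrite ltrN2 invf_lt1 ?ltr0n// ltr1n.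
case: n => [|[|n]]// _; first by rewrite /harmonic_sum big_geq// ln1 addr0.
by rewrite (le_trans (strong n))// lerD2l ler_ln ?posrE ?ltr0n// ler_nat.
Qed.

Lemma harmonic_power_small (gamma eps : R) : 1 < gamma -> 0 < eps ->
  exists N : nat, forall n, (N <= n)%N -> (0 < n)%N ->
    n%:R * (n%:R `^ gamma)^-1 * harmonic_sum n < eps.
Proof.
move=> g1 e0; pose kappa := (gamma - 1) / 2.
have k0 : 0 < kappa by rewrite divr_gt0// subr_gt0.
pose T := (1 + kappa^-1) / eps.
have T0 : 0 < T by rewrite divr_gt0// addr_gt0// invr_gt0.
exists (Num.truncn (T `^ kappa^-1)).+1 => n Nn n0.
have n0r : 0 < n%:R :> R by rewrite ltr0n.
have n1 : 1 <= n%:R :> R by rewrite ler1n.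
have Tn : T < n%:R `^ kappa.
  have -> : T = (T `^ kappa^-1) `^ kappa.
    by rewrite -powRrM mulVf ?gt_eqF// powRr1// ltW.
  rewrite gt0_ltr_powR ?nnegrE ?powR_ge0//.
  by rewrite (lt_le_trans (truncnS_gt _))// ler_nat.
have pk0 : 0 < n%:R `^ kappa by rewrite powR_gt0.
have Hn : harmonic_sum n <= (1 + kappa^-1) * n%:R `^ kappa.
  rewrite (le_trans (harmonic_sum_le_ln n0))// mulrDl mul1r lerD//.
    by have := ler_powR n1 (ltW k0); rewrite powRr0.
  rewrite -ler_pdivrMl ?invr_gt0// invrK -ln_powR ltW//.
  exact: ln_sublinear.
have gE : n%:R `^ gamma = n%:R * n%:R `^ kappa * n%:R `^ kappa.
  rewrite -[X in _ = X * _ * _](@powRr1 R n%:R)// -!powRD ?(gt_eqF n0r) ?implybT//.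
  by congr powR; rewrite /kappa; field.
have c0 : 0 <= n%:R * (n%:R `^ gamma)^-1 :> R by rewrite mulr_ge0 ?invr_ge0 ?powR_ge0.
apply: (le_lt_trans (ler_wpM2l c0 Hn)); rewrite gE.
have -> : n%:R * (n%:R * n%:R `^ kappa * n%:R `^ kappa)^-1 *
    ((1 + kappa^-1) * n%:R `^ kappa) = (1 + kappa^-1) / n%:R `^ kappa.
  by field; rewrite !gt_eqF.
by rewrite ltr_pdivrMr// mulrC -ltr_pdivrMr.
Qed.
End harmonic_numbers.

(** * Sums over one period of a rational rotation *)

Section block_sum.
Variable R : realType.
Implicit Types (rho t : R).

Lemma normc_cexpi_diff s t :
  normc (cexpi s - cexpi t : R[i]) = normc (cexpi (s - t) - 1).
Proof.
have -> : cexpi s = cexpi (s - t) * cexpi t by rewrite -cexpiD subrK.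
by rewrite -[X in _ - X]mul1r -mulrBl normcM normc_cexpi mulr1.
Qed.

Lemma normc_cexpi_frac_ge (n j : nat) : (0 < j < n)%N ->
  cos (1 : R) * ((minn j (n - j))%:R / n%:R) <=
    normc (cexpi (2 * pi * (j%:R / n%:R)) - 1 : R[i]).
Proof.
move=> /andP[j0 jn].
have n0 : 0 < n%:R :> R by rewrite ltr0n (ltn_trans j0).
have c0 := ltW (cos1_gt0 R).
have le_frac (k : nat) : (minn j (n - j) <= k)%N ->
    cos (1 : R) * ((minn j (n - j))%:R / n%:R) <= cos 1 * (k%:R / n%:R).
  by move=> mk; rewrite ler_wpM2l// ler_pM2r ?invr_gt0// ler_nat.
have [jh|jh] := leP (j%:R / n%:R) (1 / 2 : R).
  have := @normc_cexpi_sub1_ge R (j%:R / n%:R).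
  rewrite ger0_norm ?divr_ge0// => /(_ jh); apply: le_trans.
  exact: le_frac (geq_minl _ _).
have njE : (n - j)%:R / n%:R = 1 - j%:R / n%:R :> R.
  by rewrite natrB 1?ltnW// mulrBl divff// gt_eqF.
have := @normc_cexpi_sub1_ge R (j%:R / n%:R - 1).
have -> : 2 * pi * (j%:R / n%:R - 1) = 2 * pi * (j%:R / n%:R + (-1)%:~R).
  by [].
rewrite cexpi_period distrC ger0_norm -njE; last by rewrite divr_ge0.
have jh' : (n - j)%:R / n%:R <= 1 / 2 :> R by rewrite njE; lra.
move=> /(_ jh'); apply: le_trans.
exact: le_frac (geq_minr _ _).
Qed.

(** Bounding 1 / min(j, n - j) by the sum of the two inverses makes the bound
summable in closed form. *)
Lemma inv_normc_cexpi_frac_le (n j : nat) : (0 < j < n)%N ->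
  (normc (cexpi (2 * pi * (j%:R / n%:R)) - 1 : R[i]))^-1 <=
    (cos (1 : R))^-1 * n%:R * (j%:R^-1 + (n - j)%:R^-1).
Proof.
move=> j1n; have /andP[j0 jn] := j1n.
have n0 : 0 < n%:R :> R by rewrite ltr0n (ltn_trans j0).
have m0 : 0 < (minn j (n - j))%:R :> R by rewrite ltr0n leq_min j0 subn_gt0.
have c0 := cos1_gt0 R.
have p0 : 0 < cos 1 * ((minn j (n - j))%:R / n%:R) :> R by rewrite mulr_gt0// divr_gt0.
have ge := normc_cexpi_frac_ge j1n.
apply: (@le_trans _ _ (cos (1 : R) * ((minn j (n - j))%:R / n%:R))^-1).
  by rewrite lef_pV2// posrE// (lt_le_trans p0).
have -> : (cos (1 : R) * ((minn j (n - j))%:R / n%:R))^-1 =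
    (cos 1)^-1 * n%:R * (minn j (n - j))%:R^-1 by field; rewrite !gt_eqF.
rewrite ler_wpM2l ?mulr_ge0 ?invr_ge0 ?(ltW c0) ?(ltW n0)//.
by have [_|_] := leqP j (n - j); rewrite ?lerDl ?lerDr invr_ge0.
Qed.

Lemma sum_normc_cexpi_frac (n : nat) : (0 < n)%N ->
  \sum_(1 <= j < n) (normc (cexpi (2 * pi * (j%:R / n%:R)) - 1 : R[i]))^-1 <=
    2 * (cos (1 : R))^-1 * n%:R * harmonic_sum R n.
Proof.
move=> n0.
apply: (@le_trans _ _ (\sum_(1 <= j < n)
    (cos (1 : R))^-1 * n%:R * (j%:R^-1 + (n - j)%:R^-1))).
  rewrite !big_nat; apply: ler_sum => j j1n; exact: inv_normc_cexpi_frac_le.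
rewrite -mulr_sumr big_split /=.
have -> : \sum_(1 <= j < n) (n - j)%:R^-1 = harmonic_sum R n.
  rewrite big_nat_rev /harmonic_sum !big_nat; apply: eq_bigr => j j1n.
  by congr (_%:R^-1); lia.
rewrite -/(harmonic_sum R n); rewrite le_eqVlt; apply/orP; left; apply/eqP; ring.
Qed.

(** The points e(t + i rho) are nearly equally spaced: i m runs through all
residues modulo n, and i rho differs from a translate of i m / n by at most eta,
which is small against 1 / n.  Let i0 be the index of the term nearest to 0.  For
i <> i0 the triangle inequality gives
  |C| |e((i - i0) rho) - 1| <= u_i + u_i0 <= 2 u_i,
so the sum over i <> i0 is controlled by inverse chords, whatever a is.  The
single term i0 is bounded through d. *)
Lemma block_sum_le rho (n : nat) (m : int) (eta delta d t : R) (a C : R[i]) :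
  (0 < n)%N -> coprimez n m -> `|n%:R * rho - m%:~R| <= eta ->
  4 * pi * eta * n%:R <= cos (1 : R) -> C != 0 -> 0 < delta ->
  (forall i : nat, d <= normc (a + C * cexpi (2 * pi * (t + i%:R * rho)))) ->
  \sum_(i < n) delta / Num.max delta (normc (a + C * cexpi (2 * pi * (t + i%:R * rho))))
  <= delta / Num.max delta d +
     delta * (8 * (cos (1 : R))^-1 / normc C) * n%:R * harmonic_sum R n.
Proof.
move=> n0 cop nm eta_small C0 delta0 dle.
pose e s : R[i] := cexpi (2 * pi * s).
pose u (i : nat) := normc (a + C * e (t + i%:R * rho)).
pose W (j : nat) : R := normc (e (j%:R / n%:R) - 1).
have nr0 : 0 < n%:R :> R by rewrite ltr0n.
have C0r : 0 < normc C by rewrite lt_neqAle eq_sym normc_eq0 C0 normc_ge0.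
case: n n0 => // n _ in W cop nm eta_small nr0 *.
pose i0 := [arg min_(i < (ord0 : 'I_n.+1)) u i]%O.
have i0min (i : 'I_n.+1) : u i0 <= u i by rewrite /i0; case: arg_minP => // k _ /(_ i isT).
(* The residue of (i - i0) m, a permutation of the indices sending i0 to 0. *)
pose h (i : 'I_n.+1) : 'I_n.+1 :=
  inord `|(((Posz i - Posz i0) * m) %% n.+1)%Z|%N.
have hE (i : 'I_n.+1) : exists q : int, (Posz i - Posz i0) * m = q * n.+1%:Z + Posz (h i).
  exists (((Posz i - Posz i0) * m) %/ n.+1)%Z.
  rewrite {1}(divz_eq ((Posz i - Posz i0) * m) n.+1); congr (_ + _).
  rewrite inordK; first by rewrite gez0_abs// modz_ge0.
  by rewrite -ltz_nat gez0_abs ?modz_ge0// ltz_pmod.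
have h_inj : injective h.
  move=> i j hij; have [q qE] := hE i; have [r rE] := hE j.
  have : (n.+1%:Z %| (Posz i - Posz j) * m)%Z.
    apply/dvdzP; exists (q - r).
    have -> : (Posz i - Posz j) * m = (Posz i - Posz i0) * m - (Posz j - Posz i0) * m by ring.
    by rewrite qE rE hij; ring.
  rewrite Gauss_dvdzl// => /dvdzP[k kE]; apply/val_inj => /=.
  move: (ltn_ord i) (ltn_ord j) kE; move: (nat_of_ord i) (nat_of_ord j) => b c bn cn kE.
  have [k1|k1|k0] := ltgtP k 0; [nia|nia|].
  by move: kE; rewrite k0 mul0r; lia.
have h0 (i : 'I_n.+1) : (h i == ord0) = (i == i0).
  have -> : ord0 = h i0.
    by apply/val_inj; rewrite /h subrr mul0r mod0z /= inordK.
  by rewrite (inj_eq h_inj).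
have frac_ge (j : nat) : (0 < j < n.+1)%N -> cos 1 / n.+1%:R <= W j.
  move=> j1n; apply: le_trans (normc_cexpi_frac_ge j1n).
  rewrite ler_wpM2l ?(ltW (cos1_gt0 R))// -[leLHS]mul1r ler_pM2r ?invr_gt0//.
  by rewrite ler1n leq_min subn_gt0.
have ulow (i : 'I_n.+1) : i != i0 -> normc C / 4 * W (h i) <= u i.
  move=> ii0.
  have ui : normc C * normc (e ((Posz i - Posz i0)%:~R * rho) - 1) <= 2 * u i.
    have -> : normc (e ((Posz i - Posz i0)%:~R * rho) - 1) =
        normc (e (t + i%:R * rho) - e (t + i0%:R * rho)).
      rewrite normc_cexpi_diff -mulrBr; congr (normc (cexpi (2 * pi * _) - 1)).
      by rewrite rmorphB /=; ring.
    rewrite -normcM mulrBr.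
    have -> : C * e (t + i%:R * rho) - C * e (t + i0%:R * rho) =
      (a + C * e (t + i%:R * rho)) - (a + C * e (t + i0%:R * rho)) by ring.
    rewrite (le_trans (le_normcD _ _))// normcN [leRHS]mulr_natl mulr2n lerD2l.
    exact: i0min.
  have Wi : W (h i) <= normc (e ((Posz i - Posz i0)%:~R * rho) - 1) + 2 * pi * eta.
    have [q qE] := hE i.
    have -> : W (h i) = normc (e ((Posz i - Posz i0)%:~R * m%:~R / n.+1%:R) - 1).
      rewrite /W /e -intrM qE intrD intrM -!pmulrn (mulrDl (q%:~R * n.+1%:R)) mulfK ?gt_eqF//.
      by rewrite [q%:~R + _]addrC cexpi_period.
    rewrite -(subrKA (e ((Posz i - Posz i0)%:~R * rho))) addrC.
    rewrite (le_trans (le_normcD _ _))// lerD2l normc_cexpi_diff -mulrBr.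
    rewrite (le_trans (normc_cexpi_sub1_le _))// normrM.
    rewrite ger0_norm ?mulr_ge0 ?pi_ge0// ler_wpM2l ?mulr_ge0 ?pi_ge0//.
    apply: le_trans nm.
    have -> : (Posz i - Posz i0)%:~R * m%:~R / n.+1%:R - (Posz i - Posz i0)%:~R * rho
      = - ((Posz i - Posz i0)%:~R / n.+1%:R * (n.+1%:R * rho - m%:~R)).
      by field; rewrite gt_eqF.
    rewrite normrN normrM ler_piMl// normrM normfV.
    rewrite [`|n.+1%:R|](ger0_norm (ltW nr0)) ler_pdivrMr// mul1r.
    rewrite -intr_norm -[n.+1%:R]/((Posz n.+1)%:~R) ler_int.
    by have := ltn_ord i; have := ltn_ord i0; lia.
  have Whi : 4 * pi * eta <= W (h i).
    have hi0 : (0 < h i < n.+1)%N by rewrite ltn_ord andbT lt0n -[_ == _]/(h i == ord0) h0.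
    apply: le_trans (frac_ge _ hi0).
    by rewrite ler_pdivlMr.
  have := ler_wpM2l (ltW C0r) Wi; rewrite mulrDr.
  have := ler_wpM2l (ltW C0r) Whi; lra.
have max0 x : 0 < Num.max delta x by rewrite lt_max delta0.
rewrite (bigD1 i0) //=; apply: lerD.
  rewrite ler_wpM2l ?(ltW delta0)// lef_pV2 ?posrE//.
  by rewrite ge_max le_max lexx /= le_max (dle i0) orbT.
rewrite (@le_trans _ _ (\sum_(i < n.+1 | i != i0) delta * (4 / normc C) * (W (h i))^-1))//.
  apply: ler_sum => i ii0.
  have W0 : 0 < W (h i).
    have hi0 : (0 < h i < n.+1)%N by rewrite ltn_ord andbT lt0n -[_ == _]/(h i == ord0) h0.
    apply: lt_le_trans (frac_ge _ hi0).
    by rewrite divr_gt0// cos1_gt0.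
  rewrite -[leRHS]mulrA ler_wpM2l ?(ltW delta0)//.
  have -> : 4 / normc C / W (h i) = (normc C / 4 * W (h i))^-1.
    by field; rewrite !gt_eqF.
  rewrite lef_pV2 ?posrE//; last by rewrite mulr_gt0// divr_gt0.
  by rewrite le_max ulow// orbT.
rewrite (eq_bigl (fun i => h i != ord0)); last by move=> i; rewrite h0.
have /= <- := @reindex_inj _ _ 0 _ h (fun j : 'I_n.+1 => j != ord0)
  (fun j : 'I_n.+1 => delta * (4 / normc C) * (W j)^-1) h_inj.
rewrite -mulr_sumr big_mkcond big_ord_recl /= add0r.
have -> : \sum_(i < n) (W (lift ord0 i))^-1 = \sum_(1 <= j < n.+1) (W j)^-1.
  by rewrite big_add1 /= big_mkord.
have := @sum_normc_cexpi_frac n.+1 isT.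
have dC : 0 <= delta * (4 / normc C) by rewrite mulr_ge0 ?divr_ge0 ?ltW.
move=> /(ler_wpM2l dC) /le_trans; apply; rewrite le_eqVlt; apply/orP; left; apply/eqP; field.
by rewrite !gt_eqF// cos1_gt0.
Qed.

End block_sum.

(** * Recurrence of sets of positive measure, and integrals along orbits *)

Section recurrence.
Variable R : realType.
Local Notation mu := (@lebesgue_measure R).
Implicit Types (S : set R).

(** Uniform continuity of translation on a compact set. *)
Lemma compact_translate_in_open (K U : set R) : compact K -> open U -> K `<=` U ->
  exists2 r : R, 0 < r & forall theta, `|theta| < r -> forall x, K x -> U (x + theta).
Proof.
move=> cK oU KU.
have := @compact_near_coveringP R K; case=> /(_ cK) ncK _.
have [|r r0 Hr] := ncK R (nbhs (0 : R)) (fun theta x => U (x + theta)) _ _.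
  move=> x Kx.
  have : (fun z : R * R => z.1 + z.2) @ (x, 0 : R) --> x + 0.
    apply: cvgD; [exact: cvg_fst|exact: cvg_snd].
  apply; rewrite addr0; exact: (open_nbhs_nbhs (conj oU (KU _ Kx))).
exists r => // theta tr x Kx; apply: (Hr theta) => //.
by rewrite /= sub0r normrN.
Qed.

Lemma measure_setD_add (A B : set R) : measurable A -> measurable B -> B `<=` A ->
  (mu (A `\` B) + mu B = mu A)%E.
Proof.
move=> mA mB BA; have mAB : measurable (A `\` B) by exact: measurableD.
rewrite -[in RHS](setDKU BA) (measureU mu mAB mB)//.
by apply/seteqP; split => x /= [] [].  
Qed.

(** Sandwich most of S between a compact set K and an open set U of nearly the same
measure.  K and K - theta both lie in U, too small to contain them disjointly. *)
Lemma translate_intersection_ge S : measurable S -> (mu S < +oo)%E -> (0 < mu S)%E ->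
  exists c r : R, [/\ 0 < c, 0 < r & forall theta, `|theta| < r ->
    (c%:E <= mu [set x | S x /\ S (x + theta)%R])%E].
Proof.
move=> mS Sfin S0.
have Sfn : mu S \is a fin_num by rewrite ge0_fin_numE.
pose m := fine (mu S).
have mE : mu S = m%:E by rewrite fineK.
have m0 : 0 < m by rewrite -lte_fin -mE.
have m4 : 0 < m / 4 by rewrite divr_gt0.
have [K [cK KS SK]] := lebesgue_regularity_inner mS Sfin m4.
have mK : measurable K by apply: closed_measurable; apply: compact_closed => //; exact: Rhausdorff.
have Kfin : (mu K < +oo)%E by exact: compact_finite_measure.
have [U [oU KU UK]] := lebesgue_regularity_outer mK Kfin m4.
have mU : measurable U by exact: open_measurable.
have [r r0 Hr] := compact_translate_in_open cK oU KU.
exists (m / 4), r; split=> // theta tr.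
pose K' := (fun x => x + theta) @^-1` K.
have mK' : measurable K'.
  have := @measurable_preimage_affine R 1 theta K mK.
  by congr measurable; apply/seteqP; split => x /=; rewrite mul1r.
have muK' : mu K' = mu K by exact: lebesgue_measure_shift.
have K'U : K' `<=` U.
  move=> x K'x; have := Hr (- theta) _ _ K'x; rewrite normrN addrK; exact.
have mI : measurable (K `&` K') by exact: measurableI.
have mUK' : measurable (U `\` K') by exact: measurableD.
have h1 : (mu K <= mu (K `&` K') + mu (U `\` K'))%E.
  apply: le_trans (@measureU2 _ _ _ mu _ _ mI mUK').
  apply: le_outer_measure.
  move=> x Kx; have [K'x|nK'x] := pselect (K' x); first by left.
  by right; split=> //; exact: KU.
have h2 : (mu (U `\` K') + mu K = mu U)%E by rewrite -muK'; exact: measure_setD_add.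
have h3 : (mu U <= mu (U `\` K) + mu K)%E by rewrite measure_setD_add.
have h4 : (mu S <= mu (S `\` K) + mu K)%E by rewrite measure_setD_add.
have h5 : (mu (K `&` K') <= mu [set x | S x /\ S (x + theta)%R])%E.
  apply: le_outer_measure => x [Kx K'x]; split; exact: KS.
apply: le_trans h5.
have Kfn : mu K \is a fin_num by rewrite ge0_fin_numE.
have UKfn : mu (U `\` K) \is a fin_num by rewrite ge0_fin_numE// (lt_trans UK)// ltry.
have SKfn : mu (S `\` K) \is a fin_num by rewrite ge0_fin_numE// (lt_trans SK)// ltry.
have Ufn : mu U \is a fin_num.
  by rewrite ge0_fin_numE// (le_lt_trans h3)// lte_add_pinfty// ?ltey_eq ?UKfn ?Kfn.
have UK'fn : mu (U `\` K') \is a fin_num.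
  rewrite ge0_fin_numE// (le_lt_trans (_ : _ <= mu U)%E) ?ltey_eq ?Ufn//.
  by apply: le_outer_measure; exact: subDsetl.
have Ifn : mu (K `&` K') \is a fin_num.
  rewrite ge0_fin_numE// (le_lt_trans (_ : _ <= mu K)%E)//.
  by apply: le_outer_measure; exact: subIsetl.
have {}UK : (mu (U `\` K) < (m / 4)%:E)%E := UK.
have {}SK : (mu (S `\` K) < (m / 4)%:E)%E := SK.
move: h1 h2 h3 h4 UK SK; rewrite mE.
rewrite -(fineK Kfn) -(fineK UKfn) -(fineK SKfn) -(fineK Ufn) -(fineK UK'fn) -(fineK Ifn).
rewrite -!EFinD !lee_fin !lte_fin => h1 h2 h3 h4 h6 h7.
by have := EFin_inj h2; lra.
Qed.

End recurrence.

Section integrals.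
Variable R : realType.
Local Notation mu := (@lebesgue_measure R).
Local Open Scope ereal_scope.

Definition unit_itv : set R := [set x : R | (0 <= x < 1)%R].

Lemma measurable_unit_itv : measurable unit_itv.
Proof.
have -> : unit_itv = `[0%R, 1%R[%classic by apply/seteqP; split => x /=; rewrite in_itv.
exact: measurable_itv.
Qed.

Lemma mu_unit_itv : mu unit_itv = 1.
Proof.
have -> : unit_itv = `[0%R, 1%R[%classic by apply/seteqP; split => x /=; rewrite in_itv.
by rewrite lebesgue_measure_itv /= lte_fin ltr01 oppr0 adde0.
Qed.

Lemma measurable_co_itv (a b : R) : measurable [set x : R | (a <= x < b)%R].
Proof.
have -> : [set x : R | (a <= x < b)%R] = `[a, b[%classic by apply/seteqP; split => x /=; rewrite in_itv.
exact: measurable_itv.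
Qed.

Lemma continuous_affine_comp (h : R -> R) (c t : R) :
  continuous h -> continuous (fun x => h (c * x + t)%R).
Proof.
move=> ch x; apply: (@continuous_comp _ _ _ (fun x => c * x + t)%R h); last exact: ch.
apply: (@continuousD _ _ _ ( *%R c) (cst t)); last exact: cst_continuous.
exact: mulrl_continuous.
Qed.

Lemma measurable_continuous_EFin (h : R -> R) (D : set R) :
  continuous h -> measurable_fun D (EFin \o h).
Proof.
move=> ch; apply/measurable_EFinP; apply: measurable_funTS.
exact: continuous_measurable_fun.
Qed.

Lemma integral_unit_shift (h : R -> R) (t : R) :
  continuous h -> (forall x, 0 <= h x)%R ->
  \int[mu]_(w in unit_itv) (h (w + t)%R)%:E =
  \int[mu]_(w in [set x : R | (t <= x < t + 1)%R]) (h w)%:E.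
Proof.
move=> ch h0.
have := @ge0_integral_affine R 1 t _ (EFin \o h) ltr01 (measurable_co_itv t (t + 1)).
move=> -> //; last exact: measurable_continuous_EFin.
rewrite mul1e; have -> : (fun x : R => (1 * x + t)%R) @^-1` [set x : R | (t <= x < t + 1)%R] = unit_itv.
  by apply/seteqP; split => x /=; rewrite mul1r addrC lerDl ltrD2l.
by apply: eq_integral => x _ /=; rewrite mul1r.
Qed.

Lemma integral_unit_translates (h : R -> R) (N : nat) :
  continuous h -> (forall x, 0 <= h x)%R ->
  \int[mu]_(w in unit_itv) (\sum_(k < N) h (w - k.+1%:R)%R)%:E =
  \int[mu]_(w in [set x : R | (- N%:R <= x < 0)%R]) (h w)%:E.
Proof.
move=> ch h0.
under eq_integral do rewrite -sumEFin.
rewrite ge0_integral_sum; first last.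
- by move=> k w _; rewrite lee_fin.
- move=> k; have := @continuous_affine_comp h 1 (- k.+1%:R) ch.
  move=> /measurable_continuous_EFin-/(_ unit_itv).
  by congr measurable_fun; apply/funext => x /=; rewrite mul1r.
- exact: measurable_unit_itv.
elim: N => [|N IHN].
  rewrite big_ord0; apply/esym.
  rewrite (_ : [set x : R | _] = set0) ?integral_set0//.
  by apply/seteqP; split => // x /=; rewrite oppr0; lra.
rewrite big_ord_recr /= IHN.
have -> : [set x : R | (- N.+1%:R <= x < 0)%R] =
    [set x : R | (- N.+1%:R <= x < - N.+1%:R + 1)%R] `|` [set x : R | (- N%:R <= x < 0)%R].
  have := ler0n R N; rewrite -natr1; move: (N%:R : R) => n n0.
  by apply/seteqP; split => x /=; [have [] := leP (- n)%R x; [right|left]|case]; lra.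
rewrite ge0_integral_setU//=; first last.
- apply/disj_setPS => x [/= /andP[_ xN] /andP[Nx _]].
  by move: xN Nx; rewrite -natr1; lra.
- by move=> x _; rewrite lee_fin.
- exact: measurable_continuous_EFin.
- exact: measurable_co_itv.
- exact: measurable_co_itv.
by rewrite addeC -integral_unit_shift.
Qed.

(** Both sides are integrals of h over an interval ending at 0: the left one over
[-M, 0), cut into unit pieces, the right one over [-Q / alpha, 0), cut into pieces
of length 1 / alpha. *)
Lemma integral_rescaled_translates (h : R -> R) (alpha : R) (M Q : nat) :
  continuous h -> (forall x, 0 <= h x)%R -> (0 < alpha)%R ->
  (alpha * M%:R <= Q%:R)%R ->
  \int[mu]_(w in unit_itv) (\sum_(k < M) h (w - k.+1%:R)%R)%:E <=
  alpha^-1%:E * \int[mu]_(s in unit_itv) (\sum_(q < Q) h ((s - q.+1%:R) / alpha)%R)%:E.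
Proof.
move=> ch h0 a0 aMQ; have ia0 : (0 < alpha^-1)%R by rewrite invr_gt0.
pose h' (s : R) := h (alpha^-1 * s + 0)%R.
have ch' : continuous h' by exact: continuous_affine_comp.
have h'0 x : (0 <= h' x)%R by exact: h0.
have -> : \int[mu]_(s in unit_itv) (\sum_(q < Q) h ((s - q.+1%:R) / alpha)%R)%:E =
    \int[mu]_(s in unit_itv) (\sum_(q < Q) h' (s - q.+1%:R)%R)%:E.
  apply: eq_integral => s _; congr (_%:E); apply: eq_bigr => q _.
  by rewrite /h' addr0 mulrC.
rewrite !integral_unit_translates//.
have := @ge0_integral_affine R alpha^-1 0 [set x : R | (- (alpha^-1 * Q%:R) <= x < 0)%R]
  (EFin \o h) ia0 (measurable_co_itv _ _).
have mh D : measurable_fun D (EFin \o h) by exact: measurable_continuous_EFin.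
move=> /(_ (mh _)) H.
have -> : [set x : R | (- Q%:R <= x < 0)%R] = (fun x => (alpha^-1 * x + 0)%R) @^-1`
    [set x : R | (- (alpha^-1 * Q%:R) <= x < 0)%R].
  apply/seteqP; split => x /=; rewrite addr0 -mulrN ler_pM2l// pmulr_rlt0//.
rewrite -[leRHS]H; last by move=> x; rewrite lee_fin.
apply: ge0_subset_integral => //.
- exact: measurable_co_itv.
- exact: measurable_co_itv.
- exact: mh.
- by move=> x _; rewrite lee_fin.
move=> x /= /andP[Mx ->]; rewrite andbT (le_trans _ Mx)// lerN2.
by rewrite ler_pdivlMl.
Qed.

Lemma continuous_regularized_inverse (d : R -> R) (delta : R) : (0 < delta)%R ->
  continuous d -> continuous (fun s => delta / Num.max delta (d s))%R.
Proof.
move=> dl0 cd x; rewrite /continuous_at.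
apply: (@cvgM _ _ (nbhs x) _ (cst delta) (fun s => (Num.max delta (d s))^-1)%R).
  exact: cvg_cst.
apply: cvgV; first by rewrite gt_eqF// lt_max dl0.
by apply: (@continuous_max _ _ (cst delta) d); [exact: cst_continuous|exact: cd].
Qed.

(** The integrand is at most 1, increases with delta, and tends to 0 with delta
wherever d <> 0: dominated convergence along delta = 1 / (n + 1). *)
Lemma integral_regularized_inverse_small (d : R -> R) (eps : R) :
  continuous d -> (forall x, 0 <= d x)%R -> lebesgue_null [set x | d x = 0%R] ->
  (0 < eps)%R ->
  exists2 delta0 : R, (0 < delta0)%R & forall delta, (0 < delta < delta0)%R ->
    \int[mu]_(s in unit_itv) (delta / Num.max delta (d s))%R%:E < eps%:E.
Proof.
move=> cd d0 nd eps0.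
pose f (delta : R) (s : R) : R := (delta / Num.max delta (d s))%R.
have f01 delta s : (0 < delta)%R -> (0 <= f delta s <= 1)%R.
  move=> dl0; have m0 : (0 < Num.max delta (d s))%R by rewrite lt_max dl0.
  by rewrite divr_ge0 ?(ltW m0) ?(ltW dl0)//= ler_pdivrMr// mul1r le_max lexx.
have cf delta : (0 < delta)%R -> continuous (f delta).
  by move=> dl0; exact: continuous_regularized_inverse.
pose u (n : nat) := n.+1%:R^-1%R : R.
have u0 n : (0 < u n)%R by rewrite invr_gt0.
have mf n : measurable_fun unit_itv (EFin \o f (u n)).
  by apply: measurable_continuous_EFin; exact: cf.
have mfmono delta delta' s : (0 < delta <= delta')%R -> (f delta s <= f delta' s)%R.
  move=> /andP[dl0 dl]; rewrite /f.
  have dl0' := lt_le_trans dl0 dl.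
  have m0 : (0 < Num.max delta (d s))%R by rewrite lt_max dl0.
  have m0' : (0 < Num.max delta' (d s))%R by rewrite lt_max dl0'.
  rewrite ler_pdivrMr// mulrAC ler_pdivlMr//.
  have := d0 s; case: (leP delta (d s)) => h1; case: (leP delta' (d s)) => h2 ds; nra.
have ig : mu.-integrable unit_itv (cst 1%:E).
  apply/integrableP; split; first exact: measurable_cst.
  rewrite (_ : (fun x => _) = cst 1); last by apply/funext => x /=; rewrite normr1.
  rewrite (integral_cst mu measurable_unit_itv).
  have : 1 * mu unit_itv < +oo by rewrite mu_unit_itv mule1 ltry.
  exact.
have fcvg : {ae mu, forall x, unit_itv x -> (fun n => (f (u n) x)%:E) @ \oo --> 0%:E}.
  apply: lebesgue_null_subset nd => x nx; apply: contrapT => dx0; apply: nx => _.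
  have dx : (0 < d x)%R by rewrite lt_neqAle eq_sym d0 andbT; apply/eqP.
  apply/cvg_EFin; first exact: nearW.
  apply/cvgrPdist_lt => e e0 /=.
  have ed0 : (0 < e * d x)%R by rewrite mulr_gt0.
  near=> n; rewrite sub0r normrN; have /andP[f0 f1] := f01 (u n) x (u0 n).
  rewrite ger0_norm// /f ltr_pdivrMr; last by rewrite lt_max u0.
  apply: (@lt_le_trans _ _ (e * d x)%R); last by rewrite ler_pM2l// le_max lexx orbT.
  by near: n; exact: (near_infty_natSinv_lt (PosNum ed0)).
have fbnd : {ae mu, forall x n, unit_itv x -> `|(EFin \o f (u n)) x| <= (cst 1%:E) x}.
  apply: aeW => x n _; have /andP[f0 f1] := f01 (u n) x (u0 n).
  by rewrite /= ger0_norm.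
have [_ _ cvgI] := @dominated_convergence _ _ _ mu unit_itv measurable_unit_itv
  (fun n => EFin \o f (u n)) (cst 0%:E) (cst 1%:E) mf (@measurable_cst _ _ _ _ _ _) fcvg ig fbnd.
have {}cvgI : (fun n => \int[mu]_(x in unit_itv) (f (u n) x)%:E) @ \oo --> 0%:E.
  by move: cvgI; rewrite integral0.
have [n In] : exists n, \int[mu]_(x in unit_itv) (f (u n) x)%:E < eps%:E.
  have : \forall n \near \oo, \int[mu]_(x in unit_itv) (f (u n) x)%:E < eps%:E.
    by apply: (cvgI [set y | y < eps%:E]); by apply: open_ereal_lt'; rewrite lte_fin.
  by case=> n _ /(_ n (leqnn n)); exists n.
exists (u n); first exact: u0.
move=> delta /andP[dl0 dln]; apply: le_lt_trans In.
apply: ge0_le_integral => //.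
- exact: measurable_unit_itv.
- by move=> x _; rewrite lee_fin; have /andP[] := f01 delta x dl0.
- by apply: measurable_continuous_EFin; exact: cf.
- exact: mf.
- by move=> x _; rewrite lee_fin; apply: mfmono; rewrite dl0 ltW.
Unshelve. all: by end_near.
Qed.
End integrals.

(** * Products along orbits and escaping points *)

Section orbit_products.
Variable R : realType.
Local Notation mu := (@lebesgue_measure R).
Implicit Types (g : R -> R) (x w theta delta : R) (M N : nat).

Definition forward_product g M x : R := \prod_(k < M) g (x + k%:R).
Definition backward_product g M x : R := \prod_(k < M) g (x - k.+1%:R).

(** The behaviour forced on the products of |P| along x + Z by a nonzero decaying
solution of f(x) = f(x+1) P(x). *)
Definition escapes g x : Prop :=
  (forall T, exists N, forall M, (N <= M)%N -> T <= forward_product g M x) /\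
  (forall eps, 0 < eps ->
     exists N, forall M, (N <= M)%N -> backward_product g M x <= eps).

(** A uniform version of escaping; the two thresholds are only required to have
ratio above exp(1), the loss in [forward_product_le]. *)
Definition escape_level g N : set R := [set x | unit_itv x /\
  forall M, (N <= M)%N ->
    expR 1 <= forward_product g M x /\ backward_product g M x <= 2^-1].

Lemma continuous_prod_translates g (h : nat -> R) M : continuous g ->
  continuous (fun x => \prod_(k < M) g (x + h k)).
Proof.
move=> cg; elim: M => [|M IHM].
  rewrite (_ : (fun x => _) = cst 1); first by move=> x; exact: cst_continuous.
  by apply/funext => x; rewrite big_ord0.
rewrite (_ : (fun x => _) =
    (fun x => \prod_(k < M) g (x + h k)) \* (fun x => g (1 * x + h M))).
  move=> x; apply: cvgM; first exact: IHM.
  exact: (@continuous_affine_comp R g 1 (h M) cg).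
by apply/funext => x; rewrite big_ord_recr /= mul1r.
Qed.

Lemma measurable_escape_level g N : continuous g -> measurable (escape_level g N).
Proof.
move=> cg.
have -> : escape_level g N = @unit_itv R `&` \bigcap_(M in [set M | (N <= M)%N])
   ([set x | expR 1 <= forward_product g M x] `&` [set x | backward_product g M x <= 2^-1]).
  by apply/seteqP; split => x [x01 H]; split=> // M NM; have [] := H M NM.
apply: measurableI; first exact: measurable_unit_itv.
apply: bigcap_measurable; first by exists N => /=.
move=> M _; apply: measurableI; apply: closed_measurable.
- have cf : continuous (forward_product g M).
    exact: (@continuous_prod_translates g (fun k => k%:R) M cg).
  exact: (@closed_comp _ _ _ _ (fun x _ => cf x) (@closed_ge R (expR 1))).
- have cf : continuous (backward_product g M).
    exact: (@continuous_prod_translates g (fun k => - k.+1%:R) M cg).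
  exact: (@closed_comp _ _ _ _ (fun x _ => cf x) (@closed_le R 2^-1)).
Qed.

(** The escaping points of [0,1) are covered by countably many levels, so one of them
has positive measure. *)
Lemma escape_level_recurrence g : continuous g ->
  ~ lebesgue_null [set x | escapes g x /\ 0 <= x < 1] ->
  exists (N : nat) (c r : R), [/\ 0 < c, 0 < r & forall theta, `|theta| < r ->
    (c%:E <= mu [set w | escape_level g N w /\ escape_level g N (w + theta)%R])%E].
Proof.
move=> cg nn.
have [N SN] : exists N, ~ lebesgue_null (escape_level g N).
  apply: contrapT => H; apply: nn.
  apply: (@lebesgue_null_subset _ (\bigcup_N escape_level g N)); last first.
    by apply: lebesgue_null_bigcup => N; apply: contrapT => ?; apply: H; exists N.
  have half0 : 0 < 2^-1 :> R by rewrite invr_gt0.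
  move=> x [[/(_ (expR 1))[N1 H1] /(_ _ half0)[N2 H2]] x01].
  exists (maxn N1 N2) => //; split=> // M; rewrite geq_max => /andP[N1M N2M].
  by split; [exact: H1|exact: H2].
have mS := measurable_escape_level N cg.
have S1 : (mu (escape_level g N) <= 1)%E.
  rewrite -(@mu_unit_itv R); apply: le_outer_measure; by move=> x [].
have S0 : (0 < mu (escape_level g N))%E.
  rewrite lt_neqAle measure_ge0 andbT; apply/eqP => S0; apply: SN.
  by exists (escape_level g N); split.
have [c [r [c0 r0 H]]] := translate_intersection_ge mS (le_lt_trans S1 (ltry 1)) S0.
by exists N, c, r.
Qed.

Lemma prod_le_exp (I : Type) (s : seq I) (h g v : I -> R) :
  (forall i, 0 <= h i) -> (forall i, 0 <= g i) -> (forall i, 0 <= v i) ->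
  (forall i, h i <= g i * (1 + v i)) ->
  \prod_(i <- s) h i <= expR (\sum_(i <- s) v i) * \prod_(i <- s) g i.
Proof.
move=> h0 g0 v0 hg; elim: s => [|i s IHs]; first by rewrite !big_nil expR0 mul1r.
rewrite !big_cons expRD mulrACA ler_pM//; first exact: prodr_ge0.
rewrite (le_trans (hg i))// mulrC ler_wpM2r// expR_ge1Dx//.
Qed.

(** Puts the factors in the order in which they face those of the backward product. *)
Lemma forward_product_rev g M x :
  forward_product g M x = \prod_(k < M) g (x + M%:R - k.+1%:R).
Proof.
rewrite /forward_product (reindex_inj rev_ord_inj) /=; apply: eq_bigr => k _.
by congr g; rewrite -addrA -natrB.
Qed.

(** A sum below 1 forces delta < g at each point of the orbit, so that each factor
is multiplied by at most 1 + delta / g, and the exponents add up to at most 1. *)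
Lemma forward_product_le g M w theta delta : 0 < delta -> (forall u, 0 <= g u) ->
  (forall u, g (u + (M%:R + theta)) <= g u + delta) ->
  \sum_(k < M) delta / Num.max delta (g (w - k.+1%:R)) < 1 ->
  forward_product g M (w + theta) <= expR 1 * backward_product g M w.
Proof.
move=> dl0 g0 gM sum1; rewrite forward_product_rev.
have max0 k : 0 < Num.max delta (g (w - k.+1%:R)) by rewrite lt_max dl0.
have v0 k : 0 <= delta / Num.max delta (g (w - k.+1%:R)) by rewrite divr_ge0 ?ltW.
have b0 : 0 <= backward_product g M w by exact: prodr_ge0.
apply: (@le_trans _ _ (expR (\sum_(k < M) delta / Num.max delta (g (w - k.+1%:R)))
    * backward_product g M w)); last by rewrite ler_wpM2r// ler_expR ltW.
apply: prod_le_exp => // k.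
have -> : w + theta + M%:R - k.+1%:R = w - k.+1%:R + (M%:R + theta) by ring.
rewrite (le_trans (gM _))// mulrDr mulr1 lerD2l.
have v1 : delta / Num.max delta (g (w - k.+1%:R)) < 1.
  apply: le_lt_trans sum1; rewrite (bigD1 k)//= lerDl.
  by apply: sumr_ge0 => i _.
move: v1; rewrite ltr_pdivrMr// mul1r lt_max ltxx /= => dg.
have g0' : 0 < g (w - k.+1%:R) := lt_trans dl0 dg.
by rewrite max_r ?(ltW dg)// mulrC mulfVK// gt_eqF.
Qed.

Lemma escape_level_sum_ge1 g N M w theta delta : (N <= M)%N ->
  0 < delta -> (forall u, 0 <= g u) ->
  (forall u, g (u + (M%:R + theta)) <= g u + delta) ->
  escape_level g N w -> escape_level g N (w + theta) ->
  1 <= \sum_(k < M) delta / Num.max delta (g (w - k.+1%:R)).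
Proof.
move=> NM dl0 g0 gM [_ /(_ M NM)[_ Bw]] [_ /(_ M NM)[Fw _]].
rewrite leNgt; apply/negP => /(forward_product_le dl0 g0 gM) /(le_trans Fw).
have e0 : 0 < expR 1 :> R := expR_gt0 1.
apply/negP; rewrite -ltNge; nra.
Qed.

(** A multiple of the period is M + theta with M large and theta small, and the two
products then have equal factors. *)
Lemma periodic_not_escape g p : continuous g -> (forall u, 0 <= g u) -> p != 0 ->
  (forall u, g (u + p) = g u) ->
  lebesgue_null [set x | escapes g x /\ 0 <= x < 1].
Proof.
move=> cg g0 p0 gp; apply: contrapT => nn.
wlog {p0} p0 : p gp / 0 < p => [hw|].
  move: p0; rewrite neq_lt => /orP[p0|p0]; last exact: (hw p).
  apply: (hw (- p)); last by rewrite oppr_gt0.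
  by move=> u; rewrite -[in LHS]gp subrK.
have [N [c [r [c0 r0 H]]]] := escape_level_recurrence cg nn.
have gnp n u : g (u + n%:R * p) = g u.
  elim: n u => [|n IHn] u; first by rewrite mul0r addr0.
  by rewrite -natr1 mulrDl mul1r addrA gp IHn.
pose P := (Num.truncn (N.+1%:R / p)).+1.
have PpN : N.+1%:R <= P%:R * p.
  by rewrite -ler_pdivrMr// ltW// truncnS_gt.
have [k [/andP[k0 _] [m km]]] := @dirichlet_approximation R (P%:R * p) (Num.truncn r^-1).+1 isT.
(* 1 / D is less than r and at most 1. *)
set D := (Num.truncn r^-1).+1 in km.
have D0 : 0 < D%:R :> R by rewrite ltr0n.
have D1 : 1 <= D%:R :> R by rewrite ler1n.
have kmr : `|k%:R * (P%:R * p) - m%:~R| < r.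
  rewrite -ltr_pdivlMr// in km; apply: (lt_trans km).
  by rewrite mul1r invf_plt ?posrE// truncnS_gt.
have km1 : `|k%:R * (P%:R * p) - m%:~R| < 1.
  by apply: le_lt_trans km; rewrite ler_peMr.
have NkP : N.+1%:R <= k%:R * (P%:R * p).
  rewrite (le_trans PpN)// ler_peMl ?ler1n// (le_trans _ PpN)//.
have mN : N%:Z < m.
  rewrite -(ltr_int R); move: km1; rewrite ltr_norml => /andP[_].
  by move: NkP; rewrite -natr1 -[N%:~R]/(N%:R); lra.
case: m => m // in kmr km km1 mN *.
set theta := k%:R * (P%:R * p) - _ in kmr.
have := H theta kmr; apply/negP; rewrite -ltNge.
rewrite (_ : [set w | _] = set0) ?measure0 ?lte_fin//.
apply/seteqP; split=> // w [[_ /(_ m (ltnW mN))[_ Bw]] [_ /(_ m (ltnW mN))[Fw _]]].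
have FB : forward_product g m (w + theta) = backward_product g m w.
  rewrite forward_product_rev; apply: eq_bigr => i _.
  rewrite -(gnp (k * P)%N (w - _)); congr g; rewrite /theta natrM -[m%:~R]/(m%:R).
  by ring.
have e1 : 1 <= expR 1 :> R by rewrite -expR0 ler_expR.
by move: Fw; rewrite FB => /le_trans/(_ Bw); lra.
Qed.

End orbit_products.

(** * One rational frequency *)

Section trinomial_products.
Variable R : realType.
Local Notation mu := (@lebesgue_measure R).
Implicit Types (A B C : R[i]) (alpha beta gamma : R).

Definition abs_trinom A B C alpha beta x : R := normc (trinom A B C alpha beta x).

Lemma abs_trinom_ge0 A B C alpha beta x : 0 <= abs_trinom A B C alpha beta x.
Proof. exact: normc_ge0. Qed.

(** The reverse triangle inequality; the bound depends on x through alpha x only. *)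
Lemma abs_trinom_ge A B C alpha beta x :
  `|normc (A + B * cexpi (2 * pi * alpha * x)) - normc C| <= abs_trinom A B C alpha beta x.
Proof.
have Ce : normc (C * cexpi (2 * pi * beta * x)) = normc C.
  by rewrite normcM normc_cexpi mulr1.
rewrite /abs_trinom /trinom -Ce.
set a := A + _; set b := C * _.
have := le_normcD (a + b) (- a); rewrite normcN addrAC subrr add0r => h1.
have := le_normcD (a + b) (- b); rewrite normcN addrK => h2.
by rewrite ler_norml; apply/andP; split; [rewrite lerNl opprB|]; rewrite lerBlDr.
Qed.

Lemma abs_trinom_almost_period A B C alpha beta (y : R) (k l : int) x :
  alpha * y = k%:~R ->
  abs_trinom A B C alpha beta (x + y) <=
  abs_trinom A B C alpha beta x + normc C * (2 * pi * `|beta * y - l%:~R|).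
Proof.
move=> ay; rewrite /abs_trinom.
have -> : trinom A B C alpha beta (x + y) = trinom A B C alpha beta x +
   C * (cexpi (2 * pi * beta * (x + y)) - cexpi (2 * pi * beta * x)).
  rewrite /trinom mulrDr cexpiD -[2 * pi * alpha * y]mulrA ay cexpi_int mulr1.
  by ring.
rewrite (le_trans (le_normcD _ _))// lerD2l normcM ler_wpM2l ?normc_ge0//.
rewrite normc_cexpi_diff.
have -> : 2 * pi * beta * (x + y) - 2 * pi * beta * x =
   2 * pi * (beta * y - l%:~R + l%:~R) by ring.
rewrite cexpi_period (le_trans (normc_cexpi_sub1_le _))// normrM.
by rewrite [X in X * _]ger0_norm// mulr_ge0// pi_ge0.
Qed.

(** For almost every x the lower bound of [abs_trinom_ge] is positive at all the
points x + k; it has period q in k, hence is bounded below by some c > 0. *)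
Lemma rational_frequency_not_escape A B C alpha beta (q : nat) (p : int) :
  A != 0 -> B != 0 -> alpha != 0 -> (0 < q)%N -> alpha * q%:R = p%:~R ->
  lebesgue_null [set x | escapes (abs_trinom A B C alpha beta) x].
Proof.
move=> A0 B0 a0 q0 aq.
pose D x := normc (A + B * cexpi (2 * pi * alpha * x)).
apply: (@lebesgue_null_subset _ [set x | exists k : int, D (x + k%:~R) = normc C]); last first.
  apply: lebesgue_null_bigcup_int => k.
  exact: (lebesgue_null_shift k%:~R (binomial_level_null (normc C) A0 B0 a0)).
move=> x [Fx Bx]; apply: contrapT => nx.
have Dper y (j : int) : D (y + q%:R * j%:~R) = D y.
  rewrite /D [2 * pi * alpha * _]mulrDr; congr (normc (A + B * _)).
  have -> : 2 * pi * alpha * (q%:R * j%:~R) = 2 * pi * (p * j)%:~R.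
    by rewrite intrM -aq; ring.
  by rewrite cexpiD cexpi_int mulr1.
have [c c0 Hc] : exists2 c : R, 0 < c & forall k : nat, (k < q)%N ->
    c <= `|D (x + k%:R) - normc C|.
  elim: (q) => [|n [c c0 Hc]]; first by exists 1.
  have dn : 0 < `|D (x + n%:R) - normc C|.
    rewrite normr_gt0 subr_eq0; apply/eqP => E; apply: nx.
    by exists (Posz n).
  exists (Num.min c `|D (x + n%:R) - normc C|); first by rewrite lt_min c0.
  move=> k; rewrite ltnS leq_eqVlt => /orP[/eqP->|kn]; first by rewrite ge_min lexx orbT.
  by rewrite ge_min Hc.
have gc (j : int) : c <= abs_trinom A B C alpha beta (x + j%:~R).
  apply: le_trans (abs_trinom_ge _ _ _ _ _ _); rewrite -/(D _).
  have -> : x + j%:~R = x + `|(j %% q)%Z|%N%:R + q%:R * (j %/ q)%Z%:~R.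
    have -> : `|(j %% q)%Z|%N%:R = (j %% q)%Z%:~R :> R.
      by rewrite -[LHS]/((Posz _)%:~R) gez0_abs// modz_ge0// -lt0n.
    rewrite {1}(divz_eq j q) intrD intrM -[q%:~R]/(q%:R); ring.
  rewrite Dper; apply: Hc.
  by rewrite -ltz_nat gez0_abs ?modz_ge0 -?lt0n// ltz_pmod.
set E := expR (q%:R * (normc C * (2 * pi)) / c).
have [N1 H1] := Fx (E + 1); have [N2 H2] := Bx 1 ltr01.
have [n [Nn n0 [m nm]]] := dirichlet_infinitely_often (q%:R * beta) (maxn N1 N2).
have nr0 : 0 < n%:R :> R by rewrite ltr0n.
have qr0 : 0 < q%:R :> R by rewrite ltr0n.
pose M := (n * q)%N.
have NM : (maxn N1 N2 <= M)%N by rewrite (leq_trans Nn)// leq_pmulr.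
have {}H1 := H1 M (leq_trans (leq_maxl _ _) NM).
have {}H2 := H2 M (leq_trans (leq_maxr _ _) NM).
pose delta := normc C * (2 * pi) / n%:R.
have dl0 : 0 <= delta by rewrite divr_ge0 ?mulr_ge0 ?normc_ge0 ?pi_ge0 ?(ltW nr0).
have gM u : abs_trinom A B C alpha beta (u + M%:R) <= abs_trinom A B C alpha beta u + delta.
  have aM : alpha * M%:R = (n%:Z * p)%:~R by rewrite /M natrM mulrCA aq intrM.
  rewrite (le_trans (abs_trinom_almost_period A B C beta m u aM))// lerD2l.
  rewrite /delta -!mulrA; do 3! rewrite ler_wpM2l ?normc_ge0 ?pi_ge0//.
  have -> : beta * M%:R = n%:R * (q%:R * beta) by rewrite /M natrM; ring.
  by rewrite -ler_pdivlMl// in nm; rewrite mulr1 in nm.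
have : forward_product (abs_trinom A B C alpha beta) M x <= E.
  rewrite forward_product_rev.
  apply: (@le_trans _ _ (expR (\sum_(k < M) delta / c) *
      backward_product (abs_trinom A B C alpha beta) M x)).
    have dc0 : 0 <= delta / c := divr_ge0 dl0 (ltW c0).
    apply: prod_le_exp => [k|k|//|k]; try exact: abs_trinom_ge0.
    rewrite /= -addrA [M%:R - _]addrC addrA.
    rewrite (le_trans (gM _))// mulrDr mulr1 lerD2l mulrA ler_pdivlMr// mulrC.
    rewrite ler_wpM2r//; have := gc (- (k.+1%:Z)); by rewrite mulrNz.
  have -> : expR (\sum_(k < M) delta / c) = E.
    rewrite /E sumr_const card_ord -[_ *+ _]mulr_natr; congr expR.
    by rewrite /delta /M natrM; field; rewrite !gt_eqF.
  by rewrite -[leRHS]mulr1 ler_wpM2l// ltW// expR_gt0.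
move/(le_trans H1); rewrite gerDl; lra.
Qed.

End trinomial_products.

(** * Frequencies with a well approximable ratio *)

Section diophantine_case.
Variable R : realType.
Local Notation mu := (@lebesgue_measure R).
Implicit Types (A B C : R[i]) (alpha beta gamma : R).

Lemma continuous_sum_affine (h : R -> R) (c t : nat -> R) M : continuous h ->
  continuous (fun x => \sum_(k < M) h (c k * x + t k)).
Proof.
move=> ch; elim: M => [|M IHM].
  rewrite (_ : (fun x => _) = cst 0); first by move=> x; exact: cst_continuous.
  by apply/funext => x; rewrite big_ord0.
rewrite (_ : (fun x => _) = (fun x => \sum_(k < M) h (c k * x + t k)) \+
    (fun x => h (c M * x + t M))).
  move=> x; apply: cvgD; first exact: IHM.
  exact: (@continuous_affine_comp R h (c M) (t M) ch).
by apply/funext => x; rewrite big_ord_recr.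
Qed.

Lemma sum_blocks_le (F : nat -> R) (b : R) (K n : nat) :
  (forall t, \sum_(i < n) F (t + i)%N <= b) -> \sum_(q < K * n) F q <= K%:R * b.
Proof.
elim: K F => [|K IHK] F Fb; first by rewrite mul0n big_ord0 mul0r.
rewrite mulSn big_split_ord /= -nat1r mulrDl mul1r lerD//; first exact: (Fb 0%N).
apply: (IHK (fun q => F (n + q)%N)) => t; have := Fb (n + t)%N.
by congr (_ <= _); apply: eq_bigr => i _; rewrite addnA.
Qed.

(** Along s - 1, s - 2, ... the factor e(alpha x) = e(s) is constant and e(beta x) is
rotated by - beta / alpha, so that [block_sum_le] applies to each block. *)
Lemma rescaled_orbit_sum_le A B C alpha beta (n K : nat) (m : int) (delta s : R) :
  (0 < n)%N -> coprimez n m -> 0 < alpha -> C != 0 -> 0 < delta ->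
  4 * pi * `|n%:R * (beta / alpha) - m%:~R| * n%:R <= cos 1 ->
  \sum_(q < K * n) delta / Num.max delta
      (abs_trinom A B C alpha beta ((s - q.+1%:R) / alpha)) <=
  K%:R * (delta / Num.max delta
      `|normc (A + B * cexpi (2 * pi * 1 * s)) - normc C| +
    delta * (8 * (cos 1)^-1 / normc C) * n%:R * harmonic_sum R n).
Proof.
move=> n0 cop a0 C0 dl0 eta.
apply: (@sum_blocks_le (fun q => delta / Num.max delta
  (abs_trinom A B C alpha beta ((s - q.+1%:R) / alpha)))) => t.
pose a := A + B * cexpi (2 * pi * 1 * s).
pose u (i : nat) := (beta / alpha) * (s - t.+1%:R) + i%:R * - (beta / alpha).
have uE i : abs_trinom A B C alpha beta ((s - (t + i).+1%:R) / alpha) =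
    normc (a + C * cexpi (2 * pi * u i)).
  rewrite /abs_trinom /trinom /a; congr (normc (A + B * _ + C * cexpi _)).
    have -> : 2 * pi * alpha * ((s - (t + i).+1%:R) / alpha) =
      2 * pi * (s + (- ((t + i).+1)%:Z)%:~R).
      by rewrite mulrNz -pmulrn; field; rewrite gt_eqF.
    by rewrite cexpi_period mulr1.
  by rewrite /u -addSn natrD; field; rewrite gt_eqF.
under eq_bigr do rewrite uE.
apply: (@block_sum_le R (- (beta / alpha)) n (- m) `|n%:R * (beta / alpha) - m%:~R|) => //.
- by rewrite /coprimez gcdzN.
- by rewrite mulrN mulrNz -opprD normrN.
- move=> i; have := uE i; rewrite /u => <-.
  have := abs_trinom_ge A B C alpha beta ((s - (t + i).+1%:R) / alpha).
  congr (`|normc (A + B * _) - _| <= _).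
  have -> : 2 * pi * alpha * ((s - (t + i).+1%:R) / alpha) =
    2 * pi * (s + (- ((t + i).+1)%:Z)%:~R).
    by rewrite mulrNz -pmulrn; field; rewrite gt_eqF.
  by rewrite cexpi_period mulr1.
Qed.

Lemma diophantine_not_escape A B C alpha beta gamma (L : R) :
  A != 0 -> B != 0 -> C != 0 -> 0 < alpha -> 1 < gamma ->
  (forall (n : nat) (m : int), (0 < n)%N -> n%:R * (beta / alpha) != m%:~R) ->
  (forall N : nat, exists2 n : nat, (N <= n)%N &
     exists m : int, n%:R `^ gamma * `|n%:R * (beta / alpha) - m%:~R| < L) ->
  lebesgue_null [set x | escapes (abs_trinom A B C alpha beta) x /\ 0 <= x < 1].
Proof.
move=> A0 B0 C0 a0 g1 irr app; apply: contrapT.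
set g := abs_trinom A B C alpha beta => nn.
have cg : continuous g by exact: continuous_normc_trinom.
have g0 u : 0 <= g u by exact: abs_trinom_ge0.
have [N [c [r [c0 r0 H]]]] := escape_level_recurrence cg nn.
have L0 : 0 < L.
  by have [n _ [m]] := app 0%N; apply: le_lt_trans; rewrite mulr_ge0// powR_ge0.
have nC0 : 0 < normc C by rewrite lt_neqAle eq_sym normc_eq0 C0 normc_ge0.
have pi0 := pi_gt0 R.
have c10 : 0 < cos (1 : R) := cos1_gt0 R.
pose K0 := (Num.truncn r^-1).+1.
have K00 : 0 < K0%:R :> R by rewrite ltr0n.
have K01 : 1 <= K0%:R :> R by rewrite ler1n.
pose d (s : R) := `|normc (A + B * cexpi (2 * pi * 1 * s)) - normc C|.
have cd : continuous d.
  have ce : continuous (fun s => normc (A + B * cexpi (2 * pi * 1 * s))).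
    rewrite (_ : (fun s => _) = (fun s => normc (trinom A B 0 1 0 s))).
      exact: continuous_normc_trinom.
    by apply/funext => s; rewrite /trinom mul0r addr0.
  move=> s; apply: (@continuous_comp _ _ _ (fun s => normc (A + B * cexpi (2 * pi * 1 * s)) - normc C) (fun z => `|z|)).
    by apply: (@continuousB _ _ _ _ (cst (normc C))); [exact: ce|exact: cst_continuous].
  exact: norm_continuous.
have nd : lebesgue_null [set s | d s = 0].
  apply: lebesgue_null_subset (binomial_level_null (normc C) A0 B0 (oner_neq0 R)).
  by move=> s /= /eqP; rewrite normr_eq0 subr_eq0 => /eqP.
pose Z : R := 8 * (cos 1)^-1 / normc C.
have Z0 : 0 < Z by rewrite divr_gt0// mulr_gt0// invr_gt0.
pose D : R := normc C * (2 * pi * (K0%:R * L)).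
have D0 : 0 < D by rewrite !mulr_gt0.
(* Each of the two contributions to the integral is kept below e; together they
   enter with the factor (K + 1) / alpha, and K <= K0. *)
pose e : R := c * alpha / (2 * K0.+1%:R).
have e0 : 0 < e by rewrite divr_gt0 ?mulr_gt0.
have [delta0 dl00 Hdelta] := integral_regularized_inverse_small cd (fun s => normr_ge0 _) nd e0.
(* The three bounds serve, in order, the far terms of the blocks, the spacing
   condition of block_sum_le, and the requirement delta < delta0. *)
pose e' : R := Num.min (e / (D * Z)) (Num.min (cos 1 / (4 * pi * L)) (delta0 / D)).
have DZ0 : 0 < D * Z by rewrite mulr_gt0.
have pL0 : 0 < 4 * pi * L by rewrite !mulr_gt0.
have e'0 : 0 < e' by rewrite !lt_min; apply/and3P; split; exact: divr_gt0.
have [N1 HN1] := harmonic_power_small g1 e'0.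
have [n [nN n0 [m [cop nm]]]] := coprime_approximation g1 irr app
  (maxn 2 (maxn N1 (Num.truncn (alpha * N.+2%:R)).+1)).
move: nN; rewrite !geq_max => /and3P[n2 nN1 nN].
have nr0 : 0 < n%:R :> R by rewrite ltr0n.
have png : 0 < n%:R `^ gamma by rewrite powR_gt0.
have := HN1 n nN1 n0; set X := _ * harmonic_sum R n => Xe'.
have H1 : 1 <= harmonic_sum R n.
  rewrite /harmonic_sum (big_cat_nat (n := 2)) //= big_nat1 invr1 lerDl.
  by apply: sumr_ge0 => i _; rewrite invr_ge0.
have ngX : n%:R / n%:R `^ gamma <= X by rewrite ler_peMr// divr_ge0// ltW.
have gX : (n%:R `^ gamma)^-1 <= X.
  by apply: le_trans ngX; rewrite ler_peMl ?invr_ge0 ?ler1n// ltW.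
have eta1 : `|n%:R * (beta / alpha) - m%:~R| < L / n%:R `^ gamma.
  by rewrite ltr_pdivlMr// mulrC.
move: Xe'; rewrite !lt_min => /and3P[Xe Xc Xd].
have eta2 : 4 * pi * `|n%:R * (beta / alpha) - m%:~R| * n%:R <= cos 1.
  move: Xc; rewrite ltr_pdivlMr// => Xc; apply: ltW; apply: le_lt_trans Xc.
  rewrite mulrC (le_trans (_ : _ <= n%:R / n%:R `^ gamma * (4 * pi * L)))//; last first.
    by rewrite ler_wpM2r// ltW.
  have -> : n%:R / n%:R `^ gamma * (4 * pi * L) = n%:R * (4 * pi * (L / n%:R `^ gamma)) by ring.
  by rewrite ler_wpM2l// ler_wpM2l ?mulr_ge0 ?(ltW pi0)// ltW.
pose delta : R := D / n%:R `^ gamma.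
have dl0 : 0 < delta by rewrite divr_gt0.
have dldl : delta < delta0.
  by rewrite /delta mulrC -ltr_pdivlMr// (le_lt_trans gX).
have nN' : N.+2%:R < n%:R / alpha.
  by rewrite ltr_pdivlMr// mulrC (lt_le_trans (truncnS_gt _))// ler_nat.
have [K [/andP[K1 KK0] [j Kj]]] := @dirichlet_approximation R (n%:R / alpha) K0 isT.
have Kr0 : 1 <= K%:R :> R by rewrite ler1n.
have Kjr : `|K%:R * (n%:R / alpha) - j%:~R| < r.
  rewrite -ltr_pdivlMr// in Kj; apply: (lt_trans Kj).
  by rewrite mul1r invf_plt ?posrE// truncnS_gt.
have Kj1 : `|K%:R * (n%:R / alpha) - j%:~R| < 1.
  by apply: le_lt_trans Kj; rewrite ler_peMr.
have NKn : N.+2%:R < K%:R * (n%:R / alpha).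
  by rewrite (lt_le_trans nN')// ler_peMl// ltW// (lt_trans _ nN').
have jN : N%:Z < j.
  rewrite -(ltr_int R); move: Kj1; rewrite ltr_norml => /andP[_].
  by move: NKn; rewrite -!natr1 -[N%:~R]/(N%:R); lra.
case: j => M // in Kj Kjr Kj1 jN *.
set theta := K%:R * (n%:R / alpha) - _ in Kjr.
have yE : M%:R + theta = K%:R * (n%:R / alpha).
  by rewrite /theta -[M%:~R]/(M%:R) addrC subrK.
have gM u : g (u + (M%:R + theta)) <= g u + delta.
  rewrite yE.
  have ay : alpha * (K%:R * (n%:R / alpha)) = (Posz (K * n))%:~R.
    by rewrite -pmulrn natrM; field; rewrite gt_eqF.
  rewrite (le_trans (abs_trinom_almost_period A B C beta (Posz K * m) u ay))// lerD2l.
  have -> : delta = normc C * (2 * pi * (K0%:R * (L / n%:R `^ gamma))).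
    by rewrite /delta /D; ring.
  rewrite ler_wpM2l ?(ltW nC0)// ler_wpM2l ?mulr_ge0 ?(ltW pi0)//.
  have -> : beta * (K%:R * (n%:R / alpha)) - (Posz K * m)%:~R =
    K%:R * (n%:R * (beta / alpha) - m%:~R) by rewrite intrM -[K%:~R]/(K%:R); ring.
  by rewrite normrM ger0_norm// ler_pM// ?ler_nat// ltW.
pose phi (t : R) : R := delta / Num.max delta (g t).
have cphi : continuous phi by exact: continuous_regularized_inverse.
have max0 x : 0 < Num.max delta x by rewrite lt_max dl0.
have phi0 t : 0 <= phi t by rewrite divr_ge0// ltW.
have := H theta Kjr; apply/negP; rewrite -ltNge.
(* The integral over [0,1) of the sum is below c, whereas the sum is at least 1 on
   a subset of measure at least c. *)
have upper : (\int[mu]_(w in @unit_itv R) (\sum_(k < M) phi (w - k.+1%:R)%R)%:E < c%:E)%E.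
  have n1a : 1 <= n%:R / alpha by rewrite (le_trans _ (ltW nN'))// ler1n.
  (* One extra block absorbs the difference theta between M and K n / alpha. *)
  have aMQ : alpha * M%:R <= (K.+1 * n)%:R.
    move: Kj1; rewrite -[M%:~R]/(M%:R) ltr_norml => /andP[Kj1 _].
    rewrite mulrC -ler_pdivlMr// natrM -natr1 mulrDl mul1r mulrDl.
    rewrite -mulrA; lra.
  apply: (le_lt_trans (integral_rescaled_translates cphi phi0 a0 aMQ)).
  pose cst0 : R := delta * Z * n%:R * harmonic_sum R n.
  pose f (s : R) : R := delta / Num.max delta (d s).
  have cst00 : 0 <= cst0.
    by rewrite mulr_ge0 ?harmonic_sum_ge0// mulr_ge0// mulr_ge0// ltW.
  have cf : continuous f by exact: continuous_regularized_inverse.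
  have f0 s : 0 <= f s by rewrite divr_ge0// ltW.
  have le_f s : \sum_(q < K.+1 * n) phi ((s - q.+1%:R) / alpha) <= K.+1%:R * (f s + cst0).
    exact: (rescaled_orbit_sum_le A B K.+1 s n0 cop a0 C0 dl0 eta2).
  have J := Hdelta delta (introT andP (conj dl0 dldl)).
  have intE : (\int[mu]_(s in @unit_itv R) (K.+1%:R * (f s + cst0))%R%:E =
     K.+1%:R%:E * (\int[mu]_(s in @unit_itv R) (f s)%:E + cst0%:E))%E.
    under eq_integral do rewrite EFinM.
    rewrite ge0_integralZl_EFin//=; first last.
    - by apply: measurable_continuous_EFin => x; apply: cvgD; [exact: cf|exact: cvg_cst].
    - by move=> s _; rewrite lee_fin addr_ge0.
    - exact: measurable_unit_itv.
    congr (_ * _)%E; under eq_integral do rewrite EFinD.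
    rewrite ge0_integralD//=; first last.
    - exact: measurable_continuous_EFin.
    - by move=> s _; rewrite lee_fin.
    - exact: measurable_unit_itv.
    congr (_ + _)%E; have := integral_cst mu (@measurable_unit_itv R) cst0%:E.
    move=> /= ->; have : (cst0%:E * mu (@unit_itv R) = cst0%:E)%E by rewrite mu_unit_itv mule1.
    exact.
  have ia0 : 0 <= alpha^-1 by rewrite invr_ge0 ltW.
  apply: (@le_lt_trans _ _ (alpha^-1%:E * (K.+1%:R%:E *
      (\int[mu]_(s in @unit_itv R) (f s)%:E + cst0%:E)))%E).
    rewrite -intE; apply: lee_wpmul2l; first by rewrite lee_fin.
    apply: ge0_le_integral => //.
    - exact: measurable_unit_itv.
    - by move=> s _; rewrite lee_fin sumr_ge0.
    - have := @continuous_sum_affine phi (fun _ => alpha^-1) (fun q => - (q.+1%:R / alpha)) (K.+1 * n) cphi.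
      move/(@measurable_continuous_EFin _ _ (@unit_itv R)); congr measurable_fun.
      by apply/funext => w /=; under eq_bigr do rewrite mulrC -mulrBl.
    - apply: measurable_continuous_EFin => x; apply: cvgM; first exact: cvg_cst.
      by apply: cvgD; [exact: cf|exact: cvg_cst].
    - by move=> s _; rewrite lee_fin.
  have Jfin : (\int[mu]_(s in @unit_itv R) (f s)%:E)%E \is a fin_num.
    rewrite ge0_fin_numE; first by rewrite (lt_trans J)// ltry.
    by apply: integral_ge0 => s _; rewrite lee_fin.
  move: J; rewrite -(fineK Jfin) -EFinD -!EFinM !lte_fin; set J' := fine _ => J.
  have cste : cst0 < e.
    have -> : cst0 = X * (D * Z) by rewrite /cst0 /delta /X; ring.
    by rewrite -ltr_pdivlMr.
  have Kr : 0 < K.+1%:R :> R by rewrite ltr0n.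
  have s1 : alpha^-1 * (K.+1%:R * (J' + cst0)) < alpha^-1 * (K.+1%:R * (e + e)).
    by rewrite ltr_pM2l ?invr_gt0// ltr_pM2l// ltrD.
  apply: (lt_le_trans s1).
  have -> : alpha^-1 * (K.+1%:R * (e + e)) = c * (K.+1%:R / K0.+1%:R).
    have : K0.+1%:R != 0 :> R by rewrite pnatr_eq0.
    by rewrite /e; move: (K0.+1%:R : R) => kk kk0; field; rewrite kk0 gt_eqF.
  rewrite ler_piMr ?(ltW c0)// ler_pdivrMr ?ltr0n// mul1r ler_nat ltnS//.

apply: le_lt_trans upper.
set S := [set w | _].
have mS : measurable S.
  have mE := measurable_escape_level N cg.
  apply: measurableI => //.
  have := @measurable_preimage_affine R 1 theta _ mE.
  by congr measurable; apply/seteqP; split => x /=; rewrite mul1r.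
have mG (D' : set R) : measurable_fun D' (fun w : R => (\sum_(k < M) phi (w - k.+1%:R))%:E).
  have := @continuous_sum_affine phi (fun _ => 1) (fun k => - k.+1%:R) M cphi.
  move/(@measurable_continuous_EFin _ _ D'); congr measurable_fun.
  by apply/funext => w /=; under eq_bigr do rewrite mul1r.
have -> : mu S = (\int[mu]_(w in S) cst 1%:E w)%E.
  by rewrite integral_cst// mul1e.
apply: (@le_trans _ _ (\int[mu]_(w in S) (\sum_(k < M) phi (w - k.+1%:R)%R)%:E)%E).
  apply: ge0_le_integral => //.
  - exact: mG.
  - move=> w [Sw Sw']; rewrite lee_fin.
    exact: (escape_level_sum_ge1 (ltnW jN) dl0 g0 gM Sw Sw').
apply: ge0_subset_integral => //.
- exact: measurable_unit_itv.
- exact: mG.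
- by move=> w _; rewrite lee_fin sumr_ge0.
- by move=> w [[]].
Qed.
End diophantine_case.

(** * From escaping points to the theorem *)

Section all_trinomials.
Variable R : realType.
Implicit Types (A B C : R[i]) (alpha beta gamma x y : R).

Lemma normc_conj (z : R[i]) : normc (z^*)%C = normc z.
Proof. by case: z => a b; rewrite /= sqrrN. Qed.

Lemma abs_trinom_conj A B C alpha beta x :
  abs_trinom (A^*)%C (B^*)%C (C^*)%C (- alpha) (- beta) x = abs_trinom A B C alpha beta x.
Proof.
have cexpiN (t : R) : cexpi (- t) = ((cexpi t)^*)%C by rewrite /cexpi cosN sinN.
rewrite /abs_trinom /trinom !(mulrN, mulNr) !cexpiN -[RHS]normc_conj.
by rewrite !rmorphD !rmorphM.
Qed.

Lemma abs_trinom_swap A B C alpha beta x :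
  abs_trinom A B C alpha beta x = abs_trinom A C B beta alpha x.
Proof. by rewrite /abs_trinom trinom_swap. Qed.

Lemma escapes_ext (g g' : R -> R) x : (forall y, g y = g' y) -> escapes g x -> escapes g' x.
Proof. by move=> /funext ->. Qed.

Lemma cexpi_mul_period alpha y (k : int) x : alpha * y = k%:~R ->
  cexpi (2 * pi * alpha * (x + y)) = cexpi (2 * pi * alpha * x).
Proof.
by move=> ay; rewrite mulrDr cexpiD -[2 * pi * alpha * y]mulrA ay cexpi_int mulr1.
Qed.

(** Up to a unimodular factor only one frequency is left. *)
Lemma degenerate_not_escape A B C alpha beta :
  alpha != 0 -> beta != 0 -> alpha != beta -> [|| A == 0, B == 0 | C == 0] ->
  lebesgue_null [set x | escapes (abs_trinom A B C alpha beta) x /\ 0 <= x < 1].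
Proof.
move=> a0 b0 ab abc.
have cg : continuous (abs_trinom A B C alpha beta) by exact: continuous_normc_trinom.
have g0 u : 0 <= abs_trinom A B C alpha beta u by exact: abs_trinom_ge0.
case/or3P: abc => /eqP z.
- apply: (@periodic_not_escape _ _ (beta - alpha)^-1) => //.
    by rewrite invr_eq0 subr_eq0 eq_sym.
  move=> u; rewrite /abs_trinom /trinom z !add0r.
  have -> : cexpi (2 * pi * beta * (u + (beta - alpha)^-1)) =
      cexpi (2 * pi * beta * u) * cexpi (2 * pi * alpha * (beta - alpha)^-1).
    rewrite mulrDr cexpiD; congr (_ * _).
    have -> : 2 * pi * beta * (beta - alpha)^-1 =
        2 * pi * (alpha * (beta - alpha)^-1 + 1%:~R).
      by rewrite mulr1z; field; rewrite subr_eq0 eq_sym.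
    by rewrite cexpi_period mulrA.
  rewrite [2 * pi * alpha * (u + _)]mulrDr cexpiD !mulrA -mulrDl normcM.
  by rewrite normc_cexpi mulr1.
- apply: (@periodic_not_escape _ _ beta^-1) => //; first by rewrite invr_eq0.
  move=> u; rewrite /abs_trinom /trinom z !mul0r.
  by rewrite (@cexpi_mul_period beta _ 1)// mulfV.
- apply: (@periodic_not_escape _ _ alpha^-1) => //; first by rewrite invr_eq0.
  move=> u; rewrite /abs_trinom /trinom z !mul0r.
  by rewrite (@cexpi_mul_period alpha _ 1)// mulfV.
Qed.

(** A negative alpha is reduced to a positive one by conjugating P, which keeps |P|. *)
Lemma approximable_ratio_not_escape A B C alpha beta gamma (L : R) :
  alpha != 0 -> beta != 0 -> alpha != beta -> 1 < gamma ->
  (forall N : nat, exists2 n : nat, (N <= n)%N &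
     exists m : int, n%:R `^ gamma * `|n%:R * (beta / alpha) - m%:~R| < L) ->
  lebesgue_null [set x | escapes (abs_trinom A B C alpha beta) x /\ 0 <= x < 1].
Proof.
move=> a0 b0 ab g1 app.
have [abc|] := boolP [|| A == 0, B == 0 | C == 0]; first exact: degenerate_not_escape.
rewrite !negb_or => /and3P[A0 B0 C0].
have [[n [m [n0 nm]]]|irr] := pselect (exists (n : nat) (m : int),
    (0 < n)%N /\ n%:R * (beta / alpha) = m%:~R).
  apply: (@periodic_not_escape _ _ (n%:R / alpha)).
  - exact: continuous_normc_trinom.
  - by move=> u; exact: abs_trinom_ge0.
  - by rewrite mulf_neq0 ?invr_eq0// pnatr_eq0 -lt0n.
  - move=> u; rewrite /abs_trinom /trinom.
    rewrite (@cexpi_mul_period alpha _ (Posz n)); last by rewrite mulrC divfK.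
    rewrite (@cexpi_mul_period beta _ m)//.
    by rewrite -nm mulrCA mulrA.
have {}irr (n : nat) (m : int) : (0 < n)%N -> n%:R * (beta / alpha) != m%:~R.
  by move=> n0; apply/eqP => nm; apply: irr; exists n, m.
have [a_lt0|a_gt0|a_eq0] := ltgtP alpha 0; last by rewrite a_eq0 eqxx in a0.
- have := @diophantine_not_escape R (A^*)%C (B^*)%C (C^*)%C (- alpha) (- beta) gamma L.
  rewrite invrN mulrNN -!normc_eq0 !normc_conj !normc_eq0 A0 B0 C0 oppr_gt0 a_lt0.
  move=> /(_ isT isT isT isT g1 irr app); apply: lebesgue_null_subset => x [Ex x01].
  split=> //; apply: escapes_ext Ex => y; by rewrite abs_trinom_conj.
- exact: (@diophantine_not_escape R A B C alpha beta gamma L).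
Qed.

Lemma frequently_or (P Q : nat -> Prop) :
  (forall N, exists2 n, (N <= n)%N & P n \/ Q n) ->
  (forall N, exists2 n, (N <= n)%N & P n) \/ (forall N, exists2 n, (N <= n)%N & Q n).
Proof.
move=> PQ; apply: contrapT => /not_orP[nP nQ].
move/existsNP : nP => [N1 H1]; move/existsNP : nQ => [N2 H2].
have [n] := PQ (maxn N1 N2); rewrite geq_max => /andP[n1 n2] [Pn|Qn].
  by apply: H1; exists n.
by apply: H2; exists n.
Qed.

Lemma power_dist_int_lt gamma (L rho : R) (n : nat) : gamma != 0 ->
  n%:R `^ gamma * dist_int (n%:R * rho) < L ->
  exists m : int, n%:R `^ gamma * `|n%:R * rho - m%:~R| < L.
Proof.
move=> g0; have [->|n0] := posnP n.
  by rewrite powR0// !mul0r => L0; exists 0; rewrite mul0r.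
have p0 : 0 < n%:R `^ gamma by rewrite powR_gt0// ltr0n.
rewrite mulrC -ltr_pdivlMr// => /dist_int_lt[m nm]; exists m.
by rewrite mulrC -ltr_pdivlMr.
Qed.

Lemma rational_frequency (alpha : R) : rational alpha ->
  exists (q : nat) (p : int), (0 < q)%N /\ alpha * q%:R = p%:~R.
Proof.
move=> [r _ <-]; exists `|denq r|%N, (numq r).
split; first by rewrite absz_gt0 denq_neq0.
have -> : `|denq r|%N%:R = (denq r)%:~R :> R.
  by rewrite -[LHS]/((Posz _)%:~R) gez0_abs// denq_ge0.
by rewrite /ratr divfK// intr_eq0 denq_neq0.
Qed.

(** Infinitely often the minimum is attained by the same one of the two ratios; by
symmetry in (B, alpha) and (C, beta) it may be taken to be beta / alpha. *)
Lemma trinom_not_escape_unit alpha beta A B C :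
  alpha != 0 -> beta != 0 -> alpha != beta ->
  (exists2 gamma : R, 1 < gamma &
      (limn_einf (fun n : nat =>
         (n%:R `^ gamma * Num.min (dist_int (n%:R * (beta / alpha)))
                                  (dist_int (n%:R * (alpha / beta))))%:E)
       < +oo)%E)
    \/ (rational alpha \/ rational beta) ->
  lebesgue_null [set x | escapes (abs_trinom A B C alpha beta) x /\ 0 <= x < 1].
Proof.
move=> a0 b0 ab hab.
have swap A' B' C' : lebesgue_null [set x | escapes (abs_trinom A' C' B' beta alpha) x /\ 0 <= x < 1] ->
    lebesgue_null [set x | escapes (abs_trinom A' B' C' alpha beta) x /\ 0 <= x < 1].
  apply: lebesgue_null_subset => x [Ex x01]; split=> //.
  by apply: escapes_ext Ex => y; exact: abs_trinom_swap.
have ba : beta != alpha by rewrite eq_sym.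
case: hab => [[gamma g1 /limn_einf_frequently[L HL]]|hab].
  have gn0 : gamma != 0 by rewrite gt_eqF// (lt_trans ltr01).
  have [|H|H] := @frequently_or
      (fun n => exists m : int, n%:R `^ gamma * `|n%:R * (beta / alpha) - m%:~R| < L)
      (fun n => exists m : int, n%:R `^ gamma * `|n%:R * (alpha / beta) - m%:~R| < L).
  - move=> N; have [n Nn un] := HL N; exists n => //; move: un.
    by rewrite /Num.min; case: ifP => _ /(power_dist_int_lt gn0); [left|right].
  - exact: approximable_ratio_not_escape H.
  - by apply: swap; exact: approximable_ratio_not_escape H.
have [abc|] := boolP [|| A == 0, B == 0 | C == 0]; first exact: degenerate_not_escape.
rewrite !negb_or => /and3P[A0 B0 C0].
case: hab => /rational_frequency[q [p [q0 qp]]].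
- apply: lebesgue_null_subset (rational_frequency_not_escape C beta A0 B0 a0 q0 qp).
  by move=> x [].
- apply: swap.
  apply: lebesgue_null_subset (rational_frequency_not_escape B alpha A0 C0 b0 q0 qp).
  by move=> x [].
Qed.

(** Translating by k only multiplies B and C by unimodular numbers. *)
Lemma trinom_not_escape alpha beta :
  alpha != 0 -> beta != 0 -> alpha != beta ->
  (exists2 gamma : R, 1 < gamma &
      (limn_einf (fun n : nat =>
         (n%:R `^ gamma * Num.min (dist_int (n%:R * (beta / alpha)))
                                  (dist_int (n%:R * (alpha / beta))))%:E)
       < +oo)%E)
    \/ (rational alpha \/ rational beta) ->
  forall A B C, lebesgue_null [set x | escapes (abs_trinom A B C alpha beta) x].
Proof.
move=> a0 b0 ab hab A B C; apply: lebesgue_null_of_unit_interval => k.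
have := @trinom_not_escape_unit alpha beta A (B * cexpi (2 * pi * alpha * k%:~R))
  (C * cexpi (2 * pi * beta * k%:~R)) a0 b0 ab hab.
apply: lebesgue_null_subset => x [[Fx Bx] x01]; split=> //.
have gE y : abs_trinom A (B * cexpi (2 * pi * alpha * k%:~R))
    (C * cexpi (2 * pi * beta * k%:~R)) alpha beta y =
  abs_trinom A B C alpha beta (y + k%:~R) by rewrite /abs_trinom trinom_shift.
split=> [T|eps e0].
- have [N HN] := Fx T; exists N => M /HN; congr (_ <= _).
  by apply: eq_bigr => i _; rewrite gE addrAC.
- have [N HN] := Bx eps e0; exists N => M /HN; congr (_ <= _).
  by apply: eq_bigr => i _; rewrite gE addrAC.
Qed.

End all_trinomials.

Section relation.
Variable R : realType.
Implicit Types (f : R -> R[i]) (alpha beta x : R).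

Lemma four_points_relation alpha beta f (d : 'I_4 -> R[i]) x :
  \sum_(j < 4) d j * f (x + (four_points alpha beta j).1) *
     cexpi (2 * pi * (four_points alpha beta j).2 * x) =
  d 0 * f x + f (x + 1) * trinom (d 1) (d 2%:R) (d 3%:R) alpha beta x.
Proof.
rewrite 4!big_ord_recr big_ord0 /four_points /= add0r addr0 mulr0 mul0r cexpi0 !mulr1.
have -> : widen_ord (leqnSn 3) (widen_ord (leqnSn 2) (widen_ord (leqnSn 1) ord_max)) = 0 :> 'I_4.
  exact/val_inj.
have -> : widen_ord (leqnSn 3) (widen_ord (leqnSn 2) ord_max) = 1 :> 'I_4 by exact/val_inj.
have -> : widen_ord (leqnSn 3) ord_max = 2%:R :> 'I_4 by exact/val_inj.
have -> : ord_max = 3%:R :> 'I_4 by exact/val_inj.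
by rewrite /trinom; ring.
Qed.

Lemma decay_lt f x (eps : R) : 0 < eps ->
  (fun n : int => normc (f (x + n%:~R))) @ int_infty --> (0 : R) ->
  exists N : nat, forall n : int, (N <= `|n|)%N -> normc (f (x + n%:~R)) < eps.
Proof.
move=> e0 /cvgrPdist_lt/(_ eps e0)[N _ HN]; exists N => n /HN.
by rewrite sub0r normrN ger0_norm// normc_ge0.
Qed.

Lemma decaying_solution_escapes f (P : R -> R[i]) x : f x != 0 ->
  (forall k : int, f (x + k%:~R) = f (x + k%:~R + 1) * P (x + k%:~R)) ->
  (fun n : int => normc (f (x + n%:~R))) @ int_infty --> (0 : R) ->
  escapes (fun y => normc (P y)) x.
Proof.
move=> fx0 rel dec; set g := fun y => normc (P y).
have fx : 0 < normc (f x) by rewrite lt_neqAle eq_sym normc_eq0 fx0 normc_ge0.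
have g0 y : 0 <= g y by exact: normc_ge0.
have fwd M : normc (f x) = normc (f (x + M%:R)) * forward_product g M x.
  elim: M => [|M IHM]; first by rewrite /forward_product big_ord0 mulr1 addr0.
  rewrite IHM /forward_product big_ord_recr /= (rel M) normcM -/(g _).
  by rewrite -natr1 addrA -[M%:~R]/(M%:R); ring.
have bwd M : normc (f (x - M%:R)) = normc (f x) * backward_product g M x.
  elim: M => [|M IHM]; first by rewrite /backward_product big_ord0 mulr1 subr0.
  have := rel (- (M.+1)%:Z); rewrite mulrNz -[(M.+1)%:~R]/(M.+1%:R : R) => ->.
  rewrite normcM -/(g _) /backward_product big_ord_recr /= mulrA -IHM.
  by rewrite -natr1 opprD addrA subrK.
split=> [T|eps e0].
(* T may fail to be positive. *)
- pose T' := Num.max 1 T.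
  have T'0 : 0 < T' by rewrite lt_max ltr01.
  have [N HN] := decay_lt (divr_gt0 fx T'0) dec.
  exists N => M NM; have := HN (Posz M) NM; rewrite -[(Posz M)%:~R]/(M%:R : R) => fM.
  have F0 : 0 <= forward_product g M x by exact: prodr_ge0.
  apply: (@le_trans _ _ T'); first by rewrite le_max lexx orbT.
  move: fM (fwd M); rewrite ltr_pdivlMr//; have := normc_ge0 (f (x + M%:R)); nra.
- have [N HN] := decay_lt (mulr_gt0 e0 fx) dec.
  exists N => M NM; have := HN (- Posz M).
  rewrite abszN => /(_ NM); rewrite mulrNz -[(Posz M)%:~R]/(M%:R : R) bwd mulrC.
  by rewrite ltr_pM2r// => /ltW.
Qed.

(** Off a null set the relation holds along the whole coset x + Z, f decays along it,
and x does not escape; so f(x) = 0 by [decaying_solution_escapes]. *)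
Lemma decaying_dependent_is_zero alpha beta f :
  alpha != 0 -> beta != 0 -> alpha != beta ->
  (forall A B C, lebesgue_null [set x | escapes (abs_trinom A B C alpha beta) x]) ->
  tf_dependent (four_points alpha beta) f -> minimal_decay f ->
  lebesgue_ae (fun x => f x = 0).
Proof.
move=> a0 b0 ab esc [d [d0 rel]] dec; apply/lebesgue_aeE.
move/lebesgue_aeE : rel => rel; move/lebesgue_aeE : dec => dec.
have [dz|dnz] := eqVneq (d 0) 0.
  have Tnz : [|| d 1 != 0, d 2%:R != 0 | d 3%:R != 0].
    case: d0 => j; apply: contraNT; rewrite !negb_or !negbK => /and3P[/eqP d1 /eqP d2 /eqP d3].
    have : [\/ j = 0, j = 1, j = 2%:R | j = 3%:R].
      by case: j => [[|[|[|[|//]]]] jlt];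
        [constructor 1|constructor 2|constructor 3|constructor 4]; exact/val_inj.
    by case=> ->; apply/eqP.
  have null0 := lebesgue_nullU rel (trinom_zero_null a0 b0 ab Tnz).
  apply: lebesgue_null_subset (lebesgue_null_shift (- 1) null0) => x fx.
  apply: contrapT => /not_orP[/= nrel nT]; apply: fx.
  move/contrapT : nrel; rewrite four_points_relation dz mul0r add0r subrK => /eqP.
  by rewrite mulf_eq0 => /orP[/eqP//|/eqP].
pose a : R[i] := - (d 0)^-1.
have null1 := lebesgue_null_bigcup_int (fun k => lebesgue_null_shift k%:~R rel).
apply: lebesgue_null_subset (lebesgue_nullU null1 (lebesgue_nullU dec
   (esc (a * d 1) (a * d 2%:R) (a * d 3%:R)))) => x fx.
apply: contrapT => /not_orP[/= nrel /not_orP[/= ndec]]; apply.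
apply: (@decaying_solution_escapes f (trinom (a * d 1) (a * d 2%:R) (a * d 3%:R) alpha beta)).
- exact/eqP.
- move=> k; have := nrel; move/forallNP/(_ k)/contrapT; rewrite four_points_relation.
  rewrite addrC => /eqP; rewrite addr_eq0 => /eqP E.
  have -> : trinom (a * d 1) (a * d 2%:R) (a * d 3%:R) alpha beta (x + k%:~R) =
    a * trinom (d 1) (d 2%:R) (d 3%:R) alpha beta (x + k%:~R) by rewrite /trinom; ring.
  by rewrite mulrCA E /a mulrNN mulrA mulVf// mul1r.
- exact: contrapT ndec.
Qed.

End relation.

Theorem theorem1p4 (R : realType) (alpha beta : R)
  (alpha0 : alpha != 0) (beta0 : beta != 0) (alpha_beta : alpha != beta)
  (hab :
    (exists2 gamma : R, 1 < gamma &
      (limn_einf (fun n : nat =>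
         (n%:R `^ gamma * Num.min (dist_int (n%:R * (beta / alpha)))
                                  (dist_int (n%:R * (alpha / beta))))%:E)
       < +oo)%E)
    \/ (rational alpha \/ rational beta)) :
  (~ exists f : R -> R[i],
       [/\ in_L2 f, ~ lebesgue_ae (fun x => f x = 0)
         & tf_dependent (four_points alpha beta) f])
  /\
  (~ exists f : R -> R[i],
       [/\ lebesgue_measurable_fun f, ~ lebesgue_ae (fun x => f x = 0),
           tf_dependent (four_points alpha beta) f & minimal_decay f]).
Proof.
have esc := trinom_not_escape alpha0 beta0 alpha_beta hab.
split=> -[f].
- move=> [fL2 nz dep]; apply: nz.
  exact: (decaying_dependent_is_zero alpha0 beta0 alpha_beta esc dep (minimal_decay_in_L2 fL2)).
- move=> [_ nz dep dec]; apply: nz.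
  exact: (decaying_dependent_is_zero alpha0 beta0 alpha_beta esc dep dec).
Qed.
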